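(* The set of weakly Demuth random reals is not a boldface $\mathbf{\Sigma}^0_3$ subset of $2^\omega$ (i.e. it is not a $G_{\delta\sigma}$ set).
   Context: A Demuth test is a sequence $(S_m)$ of c.e. open subsets of $2^\omega$ with $\lambda(S_m)\le 2^{-m}$ and $S_m=[W_{f(m)}]^\prec$ for a function $f(m)=\lim_t g(m,t)$ with $g$ computable and the number of changes at $m$ computably bounded. A real $Z$ is weakly Demuth random if for every Demuth test there is some $m$ with $Z\notin S_m$. *)

(* Defs.v *)
From mathcomp Require Import all_boot.
Set Implicit Arguments. Unset Strict Implicit. Unset Printing Implicit Defensive.

Inductive PR : Type :=
| PZero
| PSucc
| PProj of nat
| PComp of PR & list PR
| PRec of PR & PR
| PMu of PR.

Inductive eval : PR -> seq nat -> nat -> Prop :=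
| ev_zero v : eval PZero v 0
| ev_succ v : eval PSucc v (nth 0 v 0).+1
| ev_proj i v : eval (PProj i) v (nth 0 v i)
| ev_comp f gs v ws y : evals gs v ws -> eval f ws y -> eval (PComp f gs) v y
| ev_rec0 f g v y : eval f v y -> eval (PRec f g) (0 :: v) y
| ev_recS f g n v z y :
    eval (PRec f g) (n :: v) z -> eval g (n :: z :: v) y ->
    eval (PRec f g) (n.+1 :: v) y
| ev_mu f v n :
    eval f (n :: v) 0 -> (forall m, m < n -> exists k, eval f (m :: v) k.+1) ->
    eval (PMu f) v n
with evals : seq PR -> seq nat -> seq nat -> Prop :=
| evs_nil v : evals [::] v [::]
| evs_cons g gs v y ys : eval g v y -> evals gs v ys -> evals (g :: gs) v (y :: ys).

Fixpoint decodePR (t : GenTree.tree nat) : PR :=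
  match t with
  | GenTree.Node 1 _ => PSucc
  | GenTree.Node 2 (GenTree.Leaf i :: _) => PProj i
  | GenTree.Node 3 (f :: gs) => PComp (decodePR f) (map decodePR gs)
  | GenTree.Node 4 (f :: g :: _) => PRec (decodePR f) (decodePR g)
  | GenTree.Node 5 (f :: _) => PMu (decodePR f)
  | _ => PZero
  end.

Definition prog (e : nat) : PR :=
  match (unpickle e : option (GenTree.tree nat)) with
  | Some t => decodePR t
  | None => PZero
  end.

Definition computable1 (h : nat -> nat) : Prop :=
  exists p : PR, forall x, eval p [:: x] (h x).
Definition computable2 (g : nat -> nat -> nat) : Prop :=
  exists p : PR, forall x y, eval p [:: x; y] (g x y).

Definition W (e : nat) (s : seq bool) : Prop :=
  exists y, eval (prog e) [:: pickle s] y.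

Definition real := nat -> bool.

Definition prefix_of (s : seq bool) (Z : real) : Prop :=
  forall i, i < size s -> nth false s i = Z i.

Definition prefix_str (s t : seq bool) : Prop :=
  size s <= size t /\ forall i, i < size s -> nth false s i = nth false t i.

Definition opengen (U : seq bool -> Prop) (Z : real) : Prop :=
  exists s, U s /\ prefix_of s Z.

(* lambda([U]^<) <= 2^-m.  Since lambda([U]^<) is the supremum over n of
   (#{t in 2^n | t extends some string in U}) / 2^n, this says: for every n,
   every duplicate-free list of length-n strings each extending a member of U
   has at most 2^n / 2^m elements. *)
Definition measure_le_pow2 (U : seq bool -> Prop) (m : nat) : Prop :=
  forall (n : nat) (L : seq (seq bool)),
    uniq L -> (forall t, t \in L -> size t = n) ->
    (forall t, t \in L -> exists s, U s /\ prefix_str s t) ->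
    size L * 2 ^ m <= 2 ^ n.

Definition demuth_test (S : nat -> real -> Prop) : Prop :=
  exists (f : nat -> nat) (g : nat -> nat -> nat) (b : nat -> nat),
    computable2 g /\ computable1 b /\
    (forall m, exists t0, forall t, t0 <= t -> g m t = f m) /\
    (forall m (s : seq nat), uniq s ->
        (forall t, t \in s -> g m t.+1 != g m t) -> size s <= b m) /\
    (forall m, measure_le_pow2 (W (f m)) m) /\
    (forall m Z, S m Z <-> opengen (W (f m)) Z).

Definition weakly_Demuth_random (Z : real) : Prop :=
  forall S, demuth_test S -> exists m, ~ S m Z.

Definition boldface_Sigma03 (X : real -> Prop) : Prop :=
  exists U : nat -> nat -> seq bool -> Prop,
    forall Z, X Z <-> exists i, forall j, opengen (U i j) Z.

(* Main.v *)
Require Import Defs.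
From mathcomp Require Import all_boot.
From mathcomp Require Import zify.
From Stdlib Require Import Classical ClassicalEpsilon.
Set Implicit Arguments. Unset Strict Implicit. Unset Printing Implicit Defensive.

(* Conditions are computable binary trees of positive measure. From a condition one can remove an effectively open set of small measure (hence pass one Demuth test), and, after pruning thin nodes so that every surviving node carries positive measure, restrict to a node.

Every computable tree [A] admits a Demuth test whose components are all dense in the set of paths of [A]: the m-th component catches, below every node of length l, the least node of length 2l+m+2 that still looks extendible. Wrong guesses leave [A], so the measure wasted by a version of the component is bounded by the measure that [A] loses meanwhile; starting a new version each time [A] has lost about 2^-(m+2) keeps the measure below 2^-m with at most 2^(m+2) versions.

If a G_delta set of weakly Demuth random reals met every condition below [A], a Baire argument would produce a member of it lying in all components of the test above, a contradiction. So some condition avoids it, and a generic sequence of conditions gives a weakly Demuth random real outside any given countable union of such sets. *)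

(** * Determinism and closure properties of computable functions *)

Fixpoint all_PR (P : PR -> Prop) (gs : seq PR) : Prop :=
  if gs is g :: gs' then P g /\ all_PR P gs' else True.

(** The generated principle has no hypothesis for the arguments of [PComp]; here an induction over
    that list is nested inside the fixpoint. *)
Lemma PR_nested_ind (P : PR -> Prop) :
  P PZero -> P PSucc -> (forall i, P (PProj i)) ->
  (forall f gs, P f -> all_PR P gs -> P (PComp f gs)) ->
  (forall f g, P f -> P g -> P (PRec f g)) ->
  (forall f, P f -> P (PMu f)) ->
  forall p, P p.
Proof.
move=> H0 HS Hp Hc Hr Hm; fix IH 1; case=> [||i|f gs|f g|f].
- exact: H0.
- exact: HS.
- exact: Hp.
- apply: Hc; first exact: IH.
  elim: gs => [|g gs IHgs]; first exact: I.
  by split; [exact: IH | exact: IHgs].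
- by apply: Hr; exact: IH.
- by apply: Hm; exact: IH.
Qed.

Lemma eval_compE f gs v y : eval (PComp f gs) v y -> exists2 ws, evals gs v ws & eval f ws y.
Proof. by move=> H; inversion H; subst; eexists; eassumption. Qed.

Lemma evals_consE g gs v ws : evals (g :: gs) v ws ->
  exists y ys, [/\ ws = y :: ys, eval g v y & evals gs v ys].
Proof. by move=> H; inversion H; subst; do 2 eexists; split; eauto. Qed.

Lemma evals_nilE v ws : evals [::] v ws -> ws = [::].
Proof. by move=> H; inversion H. Qed.

Lemma eval_rec0E f g v y : eval (PRec f g) (0 :: v) y -> eval f v y.
Proof. by move=> H; inversion H. Qed.

Lemma eval_recSE f g n v y : eval (PRec f g) (n.+1 :: v) y ->
  exists2 z, eval (PRec f g) (n :: v) z & eval g [:: n, z & v] y.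
Proof. by move=> H; inversion H; subst; eexists; eassumption. Qed.

Lemma eval_muE f v n : eval (PMu f) v n ->
  eval f (n :: v) 0 /\ (forall m, m < n -> exists k, eval f (m :: v) k.+1).
Proof. by move=> H; inversion H; subst. Qed.

Lemma eval_fun p v y y' : eval p v y -> eval p v y' -> y = y'.
Proof.
elim/PR_nested_ind: p v y y' => [||i|f gs IHf IHgs|f g IHf IHg|f IHf] v y y' H H'.
- by inversion H; inversion H'.
- by inversion H; inversion H'.
- by inversion H; inversion H'.
- have [ws Ew Ef] := eval_compE H; have [ws' Ew' Ef'] := eval_compE H'.
  suff E : ws = ws' by rewrite -E in Ef'; exact: IHf Ef Ef'.
  move: Ew Ew'; clear -IHgs; elim: gs IHgs ws ws' => [_|g gs IH [IHg IHgs]] ws ws'.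
    by move=> /evals_nilE -> /evals_nilE ->.
  move=> /evals_consE[y [ys [-> Ey Eys]]] /evals_consE[y' [ys' [-> Ey' Eys']]].
  by rewrite (IHg _ _ _ Ey Ey') (IH IHgs _ _ Eys Eys').
- case: v H H' => [|n v] H H'; first by inversion H.
  elim: n y y' H H' => [|n IHn] y y' H H'.
    exact: IHf (eval_rec0E H) (eval_rec0E H').
  have [z Ez Ey] := eval_recSE H; have [z' Ez' Ey'] := eval_recSE H'.
  by rewrite -(IHn _ _ Ez Ez') in Ey'; exact: IHg Ey Ey'.
- have [E1 E2] := eval_muE H; have [E1' E2'] := eval_muE H'.
  (* The search with the larger result must have met a positive value at the smaller result, where
     the other search found 0. *)
  case: (ltngtP y y') => // lt_yy'.
    by have [k Hk] := E2' _ lt_yy'; have := IHf _ _ _ E1 Hk.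
  by have [k Hk] := E2 _ lt_yy'; have := IHf _ _ _ E1' Hk.
Qed.

Definition cf (k : nat) (F : seq nat -> nat) : Prop :=
  exists p, forall v, size v = k -> eval p v (F v).

Lemma cf_ext k F G : (forall v, size v = k -> F v = G v) -> cf k F -> cf k G.
Proof. by move=> E [p Hp]; exists p => v sz; rewrite -E //; exact: Hp. Qed.

Lemma cf_nth k i : cf k (nth 0 ^~ i).
Proof. by exists (PProj i) => v _; exact: ev_proj. Qed.

Lemma cf_const k c : cf k (fun=> c).
Proof.
elim: c => [|c [p Hp]]; first by exists PZero => v _; exact: ev_zero.
exists (PComp PSucc [:: p]) => v sz; apply: (ev_comp (ws := [:: c])); last exact: ev_succ.
by apply: evs_cons; [exact: Hp | exact: evs_nil].
Qed.

(** The length clause lets a function computable on vectors of length [n] be applied to [G v]. *)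
Definition cfs (k n : nat) (G : seq nat -> seq nat) : Prop :=
  exists ps, forall v, size v = k -> size (G v) = n /\ evals ps v (G v).

Lemma cfs_nil k : cfs k 0 (fun=> [::]).
Proof. by exists [::] => v _; split => //; exact: evs_nil. Qed.

Lemma cfs_cons k n F G : cf k F -> cfs k n G -> cfs k n.+1 (fun v => F v :: G v).
Proof.
move=> [p Hp] [ps Hps]; exists (p :: ps) => v sz; have [<- HG] := Hps v sz.
by split=> //; apply: evs_cons; first exact: Hp.
Qed.

Lemma cf_comp n k F G : cf n F -> cfs k n G -> cf k (fun v => F (G v)).
Proof.
move=> [p Hp] [ps Hps]; exists (PComp p ps) => v sz; have [szG HG] := Hps v sz.
by apply: ev_comp; [exact: HG | exact: Hp].
Qed.

Local Notation cb k B := (cf k (fun v => nat_of_bool (B v))).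

(** Under [d] binders of recursions or bounded quantifiers, an outer argument is reached through [d]
    applications of [behead]. *)
Lemma cf_nthb d k i : cf k (fun w => nth 0 (iter d behead w) i).
Proof.
apply: cf_ext (cf_nth k (d + i)) => v _.
by elim: d i => [|d IH] i //=; rewrite nth_behead -IH addSnnS.
Qed.

Lemma cfs_behead d n : cfs (d + n) n (iter d behead).
Proof.
exists [seq PProj i | i <- iota d n] => v sz.
have -> : iter d behead v = drop d v.
  by elim: d v {n sz} => [|d IH] v; rewrite ?drop0 // iterS IH -drop1 drop_drop.
split; first by rewrite size_drop sz addKn.
have -> : drop d v = [seq nth 0 v i | i <- iota d n].
  apply: (@eq_from_nth _ 0); first by rewrite size_map size_iota size_drop sz addKn.
  move=> j; rewrite size_drop sz addKn => ltj.
  by rewrite (nth_map 0) ?size_iota // nth_iota // nth_drop.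
elim: (iota d n) => [|i l IH] /=; first exact: evs_nil.
by apply: evs_cons => //; exact: ev_proj.
Qed.

Lemma cf_natrec k A B N : cf k A -> cf k N ->
  cf k.+2 (fun w => B (nth 0 w 0) (nth 0 w 1) (behead (behead w))) ->
  cf k (fun v => nat_rec (fun=> nat) (A v) (fun i r => B i r v) (N v)).
Proof.
move=> [a Ha] Hn [b Hb].
suff H : cf k.+1 (fun w => nat_rec (fun=> nat) (A (behead w)) (fun i r => B i r (behead w)) (nth 0 w 0)).
  exact: cf_comp H (cfs_cons Hn (cfs_behead 0 k)).
exists (PRec a b) => -[|n v] //= [sz].
elim: n => [|n IH] /=; first by apply: ev_rec0; exact: Ha.
by apply: ev_recS; [exact: IH | apply: (Hb [:: n, _ & v]); rewrite /= sz].
Qed.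

Definition C1 f := cf 1 (fun v => f (nth 0 v 0)).
Definition C2 f := cf 2 (fun v => f (nth 0 v 0) (nth 0 v 1)).
Definition C3 f := cf 3 (fun v => f (nth 0 v 0) (nth 0 v 1) (nth 0 v 2)).
Definition C4 f := cf 4 (fun v => f (nth 0 v 0) (nth 0 v 1) (nth 0 v 2) (nth 0 v 3)).

Lemma C1_comp f k F : C1 f -> cf k F -> cf k (fun v => f (F v)).
Proof. by move=> Hf HF; apply: (cf_comp Hf (cfs_cons HF (cfs_nil k))). Qed.

Lemma C2_comp f k F G : C2 f -> cf k F -> cf k G -> cf k (fun v => f (F v) (G v)).
Proof. by move=> Hf HF HG; apply: (cf_comp Hf (cfs_cons HF (cfs_cons HG (cfs_nil k)))). Qed.

Lemma C3_comp f k F G H : C3 f -> cf k F -> cf k G -> cf k H ->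
  cf k (fun v => f (F v) (G v) (H v)).
Proof.
move=> Hf HF HG HH.
by apply: (cf_comp Hf (cfs_cons HF (cfs_cons HG (cfs_cons HH (cfs_nil k))))).
Qed.

Lemma C4_comp f k F G H I : C4 f -> cf k F -> cf k G -> cf k H -> cf k I ->
  cf k (fun v => f (F v) (G v) (H v) (I v)).
Proof.
move=> Hf HF HG HH HI.
by apply: (cf_comp Hf (cfs_cons HF (cfs_cons HG (cfs_cons HH (cfs_cons HI (cfs_nil k)))))).
Qed.

Lemma C1_succ : C1 succn.
Proof. by exists PSucc => v _; exact: ev_succ. Qed.

Lemma cf_succ k F : cf k F -> cf k (fun v => (F v).+1).
Proof. exact: C1_comp C1_succ. Qed.

Lemma C1_pred : C1 predn.
Proof.
apply: cf_ext (cf_natrec (B := fun i _ _ => i) (cf_const 1 0) (cf_nth 1 0) (cf_nth 3 0)).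
by move=> v _; case: (nth 0 v 0).
Qed.

Lemma cf_pred k F : cf k F -> cf k (fun v => (F v).-1).
Proof. exact: C1_comp C1_pred. Qed.

Lemma cf_add k F G : cf k F -> cf k G -> cf k (fun v => F v + G v).
Proof.
move=> HF HG; apply: cf_ext (cf_natrec (B := fun _ r _ => r.+1) HF HG (cf_succ (cf_nth _ 1))) => v _.
by elim: (G v) => [|n /= ->]; rewrite ?addn0 ?addnS.
Qed.

Lemma cf_sub k F G : cf k F -> cf k G -> cf k (fun v => F v - G v).
Proof.
move=> HF HG; apply: cf_ext (cf_natrec (B := fun _ r _ => r.-1) HF HG (cf_pred (cf_nth _ 1))) => v _.
by elim: (G v) => [|n /= ->]; rewrite ?subn0 ?subnS.
Qed.

Lemma C2_mul : C2 muln.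
Proof.
apply: cf_ext (cf_natrec (B := fun _ r v => r + nth 0 v 0) (cf_const 2 0) (cf_nth 2 1)
  (cf_add (cf_nth 4 1) (cf_nthb 2 4 0))) => [[|x [|y [|]]]] //= _.
by elim: y => [|n /= ->]; rewrite ?muln0 ?mulnS // addnC.
Qed.

Lemma cf_mul k F G : cf k F -> cf k G -> cf k (fun v => F v * G v).
Proof. exact: C2_comp C2_mul. Qed.

Lemma C2_exp : C2 expn.
Proof.
apply: cf_ext (cf_natrec (B := fun _ r v => nth 0 v 0 * r) (cf_const 2 1) (cf_nth 2 1)
  (cf_mul (cf_nthb 2 4 0) (cf_nth 4 1))) => [[|x [|y [|]]]] //= _.
by elim: y => [|n /= ->]; rewrite ?expn0 ?expnS.
Qed.

Lemma cf_exp k F G : cf k F -> cf k G -> cf k (fun v => F v ^ G v).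
Proof. exact: C2_comp C2_exp. Qed.


Lemma cb_ext k B B' : (forall v, size v = k -> B v = B' v) -> cb k B -> cb k B'.
Proof. by move=> E; apply: cf_ext => v /E ->. Qed.

Lemma cb_neg k B : cb k B -> cb k (fun v => ~~ B v).
Proof. by move=> HB; apply: cf_ext (cf_sub (cf_const k 1) HB) => v _; case: (B v). Qed.

Lemma cb_and k B B' : cb k B -> cb k B' -> cb k (fun v => B v && B' v).
Proof. by move=> HB HB'; apply: cf_ext (cf_mul HB HB') => v _; rewrite mulnb. Qed.

Lemma cb_or k B B' : cb k B -> cb k B' -> cb k (fun v => B v || B' v).
Proof.
move=> HB HB'; apply: cb_ext (cb_neg (cb_and (cb_neg HB) (cb_neg HB'))) => v _.
by rewrite negb_and !negbK.
Qed.

Lemma cb_leq k F G : cf k F -> cf k G -> cb k (fun v => F v <= G v).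
Proof.
move=> HF HG; apply: cf_ext (cf_sub (cf_const k 1) (cf_sub HF HG)) => v _.
by rewrite -subn_eq0; case: (F v - G v).
Qed.

Lemma cb_eq k F G : cf k F -> cf k G -> cb k (fun v => F v == G v).
Proof.
by move=> HF HG; apply: cb_ext (cb_and (cb_leq HF HG) (cb_leq HG HF)) => v _; rewrite eqn_leq.
Qed.

Lemma cf_if k B F G : cb k B -> cf k F -> cf k G -> cf k (fun v => if B v then F v else G v).
Proof.
move=> HB HF HG; apply: cf_ext (cf_add (cf_mul HB HF) (cf_mul (cb_neg HB) HG)) => v _.
by case: (B v); rewrite mul1n mul0n ?addn0.
Qed.

Lemma cf_insert1 k F : cf k.+1 (fun w => F (nth 0 w 0) (behead w)) ->
  cf k.+2 (fun w => F (nth 0 w 0) (behead (behead w))).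
Proof. by move=> H; apply: (cf_comp H (cfs_cons (cf_nth _ 0) (cfs_behead 2 k))). Qed.

Lemma cf_count k N (Q : nat -> seq nat -> bool) : cf k N ->
  cb k.+1 (fun w => Q (nth 0 w 0) (behead w)) ->
  cf k (fun v => count (fun i => Q i v) (iota 0 (N v))).
Proof.
move=> HN HQ; have HQ' := cf_insert1 (F := fun i v => Q i v) HQ.
apply: cf_ext (cf_natrec (B := fun i r v => r + Q i v) (cf_const k 0) HN
  (cf_add (cf_nth _ 1) HQ')) => v _.
elim: (N v) => [|n IH] //; rewrite -[in RHS]addn1 iotaD count_cat /= {}IH addn0.
by rewrite add0n.
Qed.

Lemma cb_all k N (Q : nat -> seq nat -> bool) : cf k N ->
  cb k.+1 (fun w => Q (nth 0 w 0) (behead w)) ->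
  cb k (fun v => all (fun i => Q i v) (iota 0 (N v))).
Proof.
move=> HN HQ; apply: cb_ext (cb_eq (cf_count HN HQ) HN) => v _.
by rewrite all_count size_iota.
Qed.

Lemma cb_has k N (Q : nat -> seq nat -> bool) : cf k N ->
  cb k.+1 (fun w => Q (nth 0 w 0) (behead w)) ->
  cb k (fun v => has (fun i => Q i v) (iota 0 (N v))).
Proof.
move=> HN HQ; apply: cb_ext (cb_leq (cf_const k 1) (cf_count HN HQ)) => v _.
by rewrite has_count.
Qed.

(** The accumulator advances only while it equals the counter and the test fails, so it freezes at
    the first success. *)
Lemma cf_find k N (Q : nat -> seq nat -> bool) : cf k N ->
  cb k.+1 (fun w => Q (nth 0 w 0) (behead w)) ->
  cf k (fun v => find (fun i => Q i v) (iota 0 (N v))).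
Proof.
move=> HN HQ; have HQ' := cf_insert1 (F := fun i v => Q i v) HQ.
have HQ'' : cf k.+2 (fun w => nth 0 w 1 + ((nth 0 w 1 == nth 0 w 0) &&
    ~~ Q (nth 0 w 0) (behead (behead w)))).
  by apply: cf_add; [exact: cf_nth|apply: cb_and; [apply: cb_eq; exact: cf_nth|exact: cb_neg]].
apply: cf_ext (cf_natrec (B := fun i r v => r + ((r == i) && ~~ Q i v)) (cf_const k 0) HN HQ'').
move=> v _; elim: (N v) => [|n IH] //.
rewrite -[in RHS]addn1 iotaD find_cat /= {}IH add0n has_find size_iota.
have := find_size (Q^~ v) (iota 0 n); rewrite size_iota.
by case: ltngtP => // [_|->] _; rewrite ?addn0 //=; case: (Q n v).
Qed.

Lemma count_ltn_iota q m : count (fun i => i < q) (iota 0 m) = minn q m.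
Proof.
elim: m => [|m IH]; first by rewrite minn0.
by rewrite -addn1 iotaD count_cat /= {}IH; lia.
Qed.

Lemma cf_div k F G : cf k F -> cf k G -> cf k (fun v => F v %/ G v).
Proof.
move=> HF HG.
suff H : C2 divn by exact: C2_comp.
(* The quotient is the number of positive multiples of the divisor up to the dividend; the guard
   returns 0 on division by 0. *)
apply: cf_ext (cf_count (Q := fun i v => (0 < nth 0 v 1) && (i.+1 * nth 0 v 1 <= nth 0 v 0)) (cf_nth 2 0) _).
  move=> [|x [|d [|]]] //= _; case: d => [|d]; first by rewrite divn0 /= count_pred0.
  rewrite (eq_count (a2 := fun i => i < x %/ d.+1)); last by move=> i /=; rewrite -leq_divRL.
  by rewrite count_ltn_iota; apply/minn_idPl; exact: leq_div.
apply: cb_and; first by apply: cb_leq; [exact: cf_const | exact: (cf_nthb 1)].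
apply: cb_leq; last exact: (cf_nthb 1).
by apply: cf_mul; [apply: cf_succ; exact: cf_nth | exact: (cf_nthb 1)].
Qed.

Lemma cf_mod k F G : cf k F -> cf k G -> cf k (fun v => F v %% G v).
Proof.
move=> HF HG; apply: cf_ext (cf_sub HF (cf_mul (cf_div HF HG) HG)) => v _.
by rewrite {1}(divn_eq (F v) (G v)) addKn.
Qed.

Lemma cf_odd k F : cf k F -> cb k (fun v => odd (F v)).
Proof. by move=> HF; apply: cf_ext (cf_mod HF (cf_const k 2)) => v _; rewrite modn2. Qed.

(** * Stage-bounded evaluation *)

(** At stage [t] the value 0 stands for a computation that has not halted yet, and [y.+1] for one
    that has returned [y]. *)
Definition approx (p : PR) (k : nat) (E : nat -> seq nat -> nat) : Prop :=
  [/\ cf k.+1 (fun w => E (nth 0 w 0) (behead w)),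
      forall v t t' y, t <= t' -> E t v = y.+1 -> E t' v = y.+1 &
      forall v y, size v = k -> (eval p v y <-> exists t, E t v = y.+1)].

Lemma total_approx p k F : cf k F -> (forall v, size v = k -> eval p v (F v)) ->
  approx p k (fun _ v => (F v).+1).
Proof.
move=> HF Hp; split => //.
  by apply: cf_succ; apply: (cf_comp HF (cfs_behead 1 k)).
move=> v y sz; split; last by case=> t [<-]; exact: Hp.
by move=> /(eval_fun (Hp v sz)) <-; exists 0.
Qed.

Lemma comp_approxs gs k : all_PR (fun g => forall k, exists E, approx g k E) gs ->
  exists M, [/\ cfs k.+1 (size gs) (fun w => M (nth 0 w 0) (behead w)),
    forall v t t' ws, t <= t' -> M t v = [seq y.+1 | y <- ws] -> M t' v = [seq y.+1 | y <- ws] &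
    forall v ws, size v = k -> (evals gs v ws <-> exists t, M t v = [seq y.+1 | y <- ws])].
Proof.
elim: gs => [_|g gs IH [/(_ k)[E [cE monoE HE]] /IH[M [cM monoM HM]]]].
  exists (fun _ _ => [::]); split=> //; first exact: cfs_nil.
  move=> v ws _; split; first by move=> /evals_nilE ->; exists 0.
  by case=> t; case: ws => // _; exact: evs_nil.
exists (fun t v => E t v :: M t v); split.
- exact: cfs_cons.
- by move=> v t t' [|y ws] //= le_t [/monoE-> // /monoM->].
move=> v ws sz; split.
  move=> /evals_consE[y [ys [-> /(HE _ _ sz)[t Et] /(HM _ _ sz)[t' Et']]]].
  exists (maxn t t'); rewrite (monoE _ _ _ _ (leq_maxl t t') Et).
  by rewrite (monoM _ _ _ _ (leq_maxr t t') Et').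
case=> t; case: ws => // y ws [Ey Eys]; apply: evs_cons.
  by apply/HE => //; exists t.
by apply/HM => //; exists t.
Qed.

Lemma cf_all_pos k n G : cfs k n G -> cf k (fun v => nat_of_bool (all (fun y => 0 < y) (G v))).
Proof.
move=> HG; suff H : cf n (fun w => nat_of_bool (all (fun y => 0 < y) w)) by exact: cf_comp H HG.
elim: n {HG} => [|n IH]; first by apply: cf_ext (cf_const 0 1) => -[].
apply: cf_ext (cb_and (cb_leq (cf_const _ 1) (cf_nth _ 0)) (cf_comp IH (cfs_behead 1 n))).
by case.
Qed.

Lemma cfs_pred k n G : cfs k n G -> cfs k n (fun v => [seq y.-1 | y <- G v]).
Proof.
move=> [ps Hps]; exists [seq PComp (proj1_sig (constructive_indefinite_description _ C1_pred)) [:: p] | p <- ps].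
case: constructive_indefinite_description => q Hq /= v /Hps[szG HG].
rewrite size_map; split=> //; elim: {n szG Hps} ps (G v) HG => [|p ps IH] ws.
  by move=> /evals_nilE ->; exact: evs_nil.
move=> /evals_consE[y [ys [-> Hy Hys]]] /=; apply: evs_cons; last exact: IH.
apply: ev_comp; last exact: (Hq [:: y]).
by apply: evs_cons => //; exact: evs_nil.
Qed.

Lemma all_pos_succ_pred s : all (fun y => 0 < y) s -> s = [seq y.+1 | y <- [seq y.-1 | y <- s]].
Proof. by elim: s => //= -[|y] s IH //= /IH <-. Qed.

Lemma exists_approx p k : exists E, approx p k E.
Proof.
elim/PR_nested_ind: p k => [||i|f gs IHf IHgs|f g IHf IHg|f IHf] k.
- exists (fun _ _ => 1); apply: (total_approx (cf_const k 0)) => v _; exact: ev_zero.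
- exists (fun _ v => (nth 0 v 0).+2).
  by apply: (total_approx (cf_succ (cf_nth k 0))) => v _; exact: ev_succ.
- exists (fun _ v => (nth 0 v i).+1); apply: (total_approx (cf_nth k i)) => v _; exact: ev_proj.
- have [M [cM monoM HM]] := comp_approxs k IHgs; have [E [cE monoE HE]] := IHf (size gs).
  exists (fun t v => if all (fun y => 0 < y) (M t v) then E t [seq y.-1 | y <- M t v] else 0).
  have unM t v ws : M t v = [seq y.+1 | y <- ws] ->
      all (fun y => 0 < y) (M t v) = true /\ [seq y.-1 | y <- M t v] = ws.
    by move=> ->; rewrite all_map -map_comp map_id_in //; split => //; apply/allP.
  split.
  + apply: cf_if; [exact: cf_all_pos cM | | exact: cf_const].
    exact: (cf_comp cE (cfs_cons (cf_nth _ 0) (cfs_pred cM))).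
  + move=> v t t' y le_t; case: ifP => // /all_pos_succ_pred Mt HEt.
    by have [-> ->] := unM _ _ _ (monoM _ _ _ _ le_t Mt); apply: monoE HEt.
  + have szM t v : size v = k -> size (M t v) = size gs.
      by have [ps Hps] := cM => sz; have [] := Hps (t :: v) (congr1 S sz).
    move=> v y sz; split.
      move=> /eval_compE[ws /(HM _ _ sz)[t Mt] Ey].
      have szws : size ws = size gs by rewrite -(szM t v) // Mt size_map.
      have [t' Et'] := (HE _ _ szws).1 Ey; exists (maxn t t').
      have [-> ->] := unM _ _ _ (monoM _ _ _ _ (leq_maxl t t') Mt).
      by apply: monoE Et'; exact: leq_maxr.
    case=> t; case: ifP => // /all_pos_succ_pred Mt Et.
    apply: ev_comp; first by apply/HM => //; exists t; exact: Mt.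
    by apply/HE; [rewrite size_map szM | exists t].
- case: k => [|k].
    (* [PRec] recurses on its first argument, so it has no value on the empty vector. *)
    exists (fun _ _ => 0); split=> //; first exact: cf_const.
    by move=> [|//] y _; split=> [H|[//]]; inversion H.
  have [E [cE monoE HE]] := IHf k; have [E' [cE' monoE' HE']] := IHg k.+2.
  (* An unfinished previous value, coded 0, leaves all later ones unfinished. *)
  pose R t n v := nat_rec (fun=> nat) (E t v)
    (fun i r => if r == 0 then 0 else E' t [:: i, r.-1 & v]) n.
  exists (fun t v => R t (head 0 v) (behead v)).
  have monoR n v t t' y : t <= t' -> R t n v = y.+1 -> R t' n v = y.+1.
    move=> le_t; elim: n y => [|n IH] y /=; first exact: monoE.
    case Er: (R t n v) => [|z] //=; rewrite (IH _ Er) /=; exact: monoE'.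
  split.
  + apply: (@cf_ext _ (fun w => R (nth 0 w 0) (nth 0 w 1) (behead (behead w)))).
      by move=> [|t [|n v]].
    apply: (cf_natrec (A := fun w => E (nth 0 w 0) (behead (behead w))) (N := fun w => nth 0 w 1)
      (B := fun i r w => if r == 0 then 0 else E' (nth 0 w 0) [:: i, r.-1 & behead (behead w)])).
    * exact: (cf_comp cE (cfs_cons (cf_nth _ 0) (cfs_behead 2 k))).
    * exact: cf_nth.
    * apply: cf_if; [by apply: cb_eq; [exact: cf_nth | exact: cf_const] | exact: cf_const |].
      apply: (cf_comp cE' (cfs_cons (cf_nthb 2 _ 0) (cfs_cons (cf_nth _ 0)
        (cfs_cons (cf_pred (cf_nth _ 1)) (cfs_behead 4 k))))).
  + by move=> v t t' y; exact: monoR.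
  + move=> [|n v] y //= [sz]; elim: n y => [|n IH] y.
      split=> [/eval_rec0E/(HE _ _ sz)//|H]; apply: ev_rec0; exact/HE.
    split=> [/eval_recSE[z /IH[t Rz]]|[t]].
      have sz2 : size [:: n, z & v] = k.+2 by rewrite /= sz.
      move=> /(HE' _ _ sz2)[t' Et']; exists (maxn t t') => /=.
      by rewrite (monoR _ _ _ _ _ (leq_maxl t t') Rz) /=; apply: monoE' Et'; exact: leq_maxr.
    move=> /=; case Rz : (R t n v) => [|z] //= Ey; apply: ev_recS.
      by apply/IH; exists t; exact: Rz.
    by apply/HE'; [rewrite /= sz | exists t].
- have [E [cE monoE HE]] := IHf k.+1.
  (* The search stops at the first argument below [t] whose value is 0 or still unknown. Only the
     former counts as success, so an undefined earlier value blocks the search as in [PMu]. *)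
  pose F t v := find (fun n => E t (n :: v) <= 1) (iota 0 t).
  exists (fun t v => if (F t v < t) && (E t (F t v :: v) == 1) then (F t v).+1 else 0).
  have FP t v n : (if (F t v < t) && (E t (F t v :: v) == 1) then (F t v).+1 else 0) = n.+1 <->
      [/\ n < t, E t (n :: v) = 1 & forall m, m < n -> 1 < E t (m :: v)].
    split.
      case: ifP => // /andP[ltF /eqP EF] [<-]; split=> // m ltm.
      by have := before_find 0 ltm; rewrite nth_iota ?(ltn_trans ltm) // add0n ltnNge => ->.
    move=> [ltn En Em].
    suff -> : F t v = n by rewrite ltn En.
    rewrite /F -[X in iota 0 X](subnKC (ltnW ltn)) iotaD find_cat size_iota.
    case: ifP => [/hasP[m]|_]; first by rewrite mem_iota add0n => /= /Em; rewrite ltnNge => /negbTE->.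
    by case Et: (t - n) => [|d]; [lia | rewrite /= En addn0].
  split.
  + have cF : cf k.+1 (fun w => F (nth 0 w 0) (behead w)).
      apply: (cf_find (N := fun w => nth 0 w 0)
        (Q := fun n w => E (nth 0 w 0) (n :: behead w) <= 1)); first exact: cf_nth.
      apply: cb_leq; last exact: cf_const.
      exact: (cf_comp cE (cfs_cons (cf_nthb 1 _ 0) (cfs_cons (cf_nth _ 0) (cfs_behead 2 k)))).
    apply: cf_if; [apply: cb_and | exact: cf_succ | exact: cf_const].
      by apply: cb_leq; [exact: cf_succ | exact: cf_nth].
    apply: cb_eq; last exact: cf_const.
    exact: (cf_comp cE (cfs_cons (cf_nth _ 0) (cfs_cons cF (cfs_behead 1 k)))).
  + move=> v t t' n le_t /FP[ltn En Em]; apply/FP; split; first exact: leq_trans le_t.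
      exact: monoE En.
    by move=> m /Em; case Emy : (E t _) => [|y] //; rewrite (monoE _ _ _ _ le_t Emy).
  + move=> v n sz; have szS m : size (m :: v) = k.+1 by rewrite /= sz.
    split.
      move=> /eval_muE[/(HE _ _ (szS n))[t Et] Em].
      have [t' Et'] : exists t', forall m, m < n -> 1 < E t' (m :: v).
        elim: n Em {t Et} => [|n IH] Em; first by exists 0.
        have [|t Et] := IH; first by move=> m ltm; apply: Em; exact: leqW.
        have [y /(HE _ _ (szS n))[t' Et']] := Em n (leqnn _).
        exists (maxn t t') => m; rewrite ltnS leq_eqVlt => /orP[/eqP->|/Et].
          by rewrite (monoE _ _ _ _ (leq_maxr t t') Et').
        by case Emy : (E t _) => [|z] //; rewrite (monoE _ _ _ _ (leq_maxl t t') Emy).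
      exists (maxn n.+1 (maxn t t')); apply/FP; split; first by rewrite leq_max leqnn.
        by apply: monoE Et; rewrite !leq_max leqnn orbT.
      move=> m /Et'; case Emy : (E t' _) => [|z] //; rewrite (monoE _ _ _ _ _ Emy) //.
      by rewrite !leq_max leqnn !orbT.
    case=> t /FP[_ En Em]; apply: ev_mu; first by apply/HE => //; exists t.
    move=> m /Em; case Emy : (E t _) => [|[|y]] // _; exists y.
    by apply/HE => //; exists t.
Qed.

(** * Indices and codes of strings *)

Fixpoint encodePR (p : PR) : GenTree.tree nat :=
  match p with
  | PZero => GenTree.Node 0 [::]
  | PSucc => GenTree.Node 1 [::]
  | PProj i => GenTree.Node 2 [:: GenTree.Leaf i]
  | PComp f gs => GenTree.Node 3 (encodePR f :: map encodePR gs)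
  | PRec f g => GenTree.Node 4 [:: encodePR f; encodePR g]
  | PMu f => GenTree.Node 5 [:: encodePR f]
  end.

Lemma encodePRK p : decodePR (encodePR p) = p.
Proof.
elim/PR_nested_ind: p => //= [f gs -> IH|f g -> ->|f ->] //; congr PComp.
by elim: gs IH => //= g gs IH [-> /IH->].
Qed.

Lemma prog_pickle t : prog (pickle t) = decodePR t.
Proof. by rewrite /prog pickleK. Qed.

Lemma prog_surj p : exists e, prog e = p.
Proof. by exists (pickle (encodePR p)); rewrite prog_pickle encodePRK. Qed.

(** Prepending a fixed block, seen on codes: codes of growing trees then arise by iterating
    computable functions. *)
Definition codecat (s : seq nat) (x : nat) : nat := foldr (fun n m => 2 ^ n * m.*2.+1) x s.

Lemma code_cat s s' : CodeSeq.code (s ++ s') = codecat s (CodeSeq.code s').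
Proof. by rewrite /CodeSeq.code foldr_cat. Qed.

Lemma C1_codecat s : C1 (codecat s).
Proof.
elim: s => [|c s IH] /=; first exact: cf_nth.
apply: cf_mul; first exact: cf_const.
apply: cf_succ; apply: (cf_ext (F := fun v => 2 * codecat s (nth 0 v 0))); first by move=> v _; rewrite mul2n.
by apply: cf_mul; first exact: cf_const.
Qed.

Lemma cf_iter k f N F : C1 f -> cf k N -> cf k F -> cf k (fun v => iter (N v) f (F v)).
Proof.
move=> Hf HN HF.
apply: cf_ext (cf_natrec (B := fun _ r _ => f r) HF HN (C1_comp Hf (cf_nth _ 1))) => v _.
by elim: (N v) => //= n ->.
Qed.

Definition constTree n : GenTree.tree nat :=
  iter n (fun t => GenTree.Node 3 [:: GenTree.Node 1 [::]; t]) (GenTree.Node 0 [::]).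

Lemma eval_constTree n v : eval (decodePR (constTree n)) v n.
Proof.
elim: n => [|n IH] /=; first exact: ev_zero.
apply: (ev_comp (ws := [:: n])); last exact: ev_succ.
by apply: evs_cons => //; exact: evs_nil.
Qed.

(* [pk] stands for [pickle], kept abstract because its values are too large to be computed during unification. *)
Lemma C1_code_constTree (pk : nat + nat -> nat) s' :
  C1 (fun n => CodeSeq.code (map pk (GenTree.encode (constTree n)) ++ s')).
Proof.
pose a := map pk [:: inl 4; inl 2; inl 0].
pose b := map pk [:: inl 1; inl 0]; pose z := [:: pk (inl 0)].
(* The encoding consists of [n] opening blocks, the zero program and [n] closing marks, and its code
   is built from the right end. *)
have E n s : CodeSeq.code (map pk (GenTree.encode (constTree n)) ++ s) =
    iter n (codecat a) (codecat b (iter n (codecat z) (CodeSeq.code s))).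
  elim: n s => [|n IH] s; first by rewrite code_cat.
  have -> : GenTree.encode (constTree n.+1) =
      [:: inl 4; inl 2; inl 0] ++ GenTree.encode (constTree n) ++ [:: inl 0].
    by rewrite /= cats0 -cats1.
  by rewrite !map_cat -!catA code_cat IH code_cat [iter n.+1 _ (CodeSeq.code s)]iterSr.
have H : cf 1 (fun v => iter (nth 0 v 0) (codecat a)
    (codecat b (iter (nth 0 v 0) (codecat z) (CodeSeq.code s')))).
  apply: (cf_iter (C1_codecat a) (cf_nth _ 0)); apply: (C1_comp (C1_codecat b)).
  by apply: (cf_iter (C1_codecat z) (cf_nth _ 0)); exact: cf_const.
by apply: cf_ext H => v _; rewrite E.
Qed.

Definition paramTree P n : GenTree.tree nat :=
  GenTree.Node 3 [:: encodePR P; GenTree.Node 2 [:: GenTree.Leaf 0]; constTree n].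

Lemma C1_code_paramTree (pk : nat + nat -> nat) P :
  C1 (fun n => CodeSeq.code (map pk (GenTree.encode (paramTree P n)))).
Proof.
pose l := inl 4 :: GenTree.encode (encodePR P) ++
  GenTree.encode (GenTree.Node 2 [:: GenTree.Leaf 0]).
have := C1_comp (C1_codecat (map pk l)) (C1_code_constTree pk [:: pk (inl 0)]).
apply: cf_ext => v _; rewrite -code_cat -[[:: pk _]]/(map pk [:: inl 0]) -!map_cat.
by congr (CodeSeq.code (map _ _)); rewrite /l /= cats0 -cats1 -!catA.
Qed.

(** The s-m-n theorem: hard-wiring [n] as a constant program leaves a fixed context around
    [constTree n], so the index is computable in [n]. *)
Lemma smn P : exists idx, C1 idx /\ forall n x y, eval (prog (idx n)) [:: x] y <-> eval P [:: x; n] y.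
Proof.
exists (fun n => pickle (paramTree P n)); split; first exact: C1_code_paramTree.
move=> n x y; rewrite prog_pickle [decodePR _]/= encodePRK; split.
  move=> /eval_compE[ws /evals_consE[a [? [-> Ha /evals_consE[b [? [-> Hb /evals_nilE ->]]]]]]].
  by rewrite (eval_fun Ha (ev_proj _ _)) (eval_fun Hb (eval_constTree _ _)).
move=> H; apply: ev_comp H; apply: evs_cons; first exact: ev_proj.
by apply: evs_cons; [exact: eval_constTree | exact: evs_nil].
Qed.

(** The program looks for a zero of the negation of [D] by unbounded search, whose variable comes
    first; hence the stage is the first argument of [D]. *)
Lemma search_index (D : nat -> nat -> nat -> bool) : C3 (fun t x n => D t x n) ->
  exists idx, C1 idx /\ forall n s, W (idx n) s <-> exists t, D t (pickle s) n.
Proof.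
move=> /cb_neg[p Hp]; have [idx [cidx Hidx]] := smn (PMu p).
exists idx; split=> // n s; split.
  case=> t /Hidx/eval_muE[/(eval_fun (Hp [:: t; pickle s; n] erefl)) /=].
  by case Dt: (D _ _ _) => // _ _; exists t.
move=> exD; case: (ex_minnP exD) => t Dt mint; exists t; apply/Hidx; apply: ev_mu.
  by have := Hp [:: t; pickle s; n] erefl; rewrite /= Dt.
move=> m ltm; exists 0; have := Hp [:: m; pickle s; n] erefl.
by rewrite /=; case Dm : (D _ _ _) => //; have := mint _ Dm; rewrite leqNgt ltm.
Qed.

(* A string of length [k] is coded by its class of naturals mod 2^k, least significant bit first, so that prefixes are remainders. *)
Fixpoint bits (k i : nat) : seq bool := if k is k'.+1 then odd i :: bits k' i./2 else [::].

Lemma size_bits k i : size (bits k i) = k.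
Proof. by elim: k i => //= k IH i; rewrite IH. Qed.

Lemma nth_bits k i c : c < k -> nth false (bits k i) c = odd (i %/ 2 ^ c).
Proof.
elim: k i c => // k IH i [|c] /= ltc; first by rewrite divn1.
by rewrite IH // expnS divnMA divn2.
Qed.

Lemma C2_pickle_bits : C2 (fun k i => pickle (bits k i)).
Proof.
(* The code is built from the end: after [c] steps the accumulator codes the last [c] bits of the
   string. *)
pose R k i n := nat_rec (fun=> nat) 0 (fun c r => 2 ^ odd (i %/ 2 ^ (k - c.+1)) * (2 * r).+1) n.
have E k i c : c <= k -> R k i c = pickle (bits c (i %/ 2 ^ (k - c))).
  elim: c => // c IH ltc; rewrite [LHS]/= -/(R k i c) IH 1?ltnW // mul2n.
  have pickle_cons b (s : seq bool) : pickle (b :: s) = 2 ^ b * (pickle s).*2.+1 by [].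
  by rewrite -(subnSK ltc) expnSr divnMA divn2 -pickle_cons.
apply: cf_ext (_ : cf 2 (fun v => R (nth 0 v 0) (nth 0 v 1) (nth 0 v 0))).
  by move=> v _; rewrite E // subnn divn1.
apply: (cf_natrec (B := fun c r v => 2 ^ odd (nth 0 v 1 %/ 2 ^ (nth 0 v 0 - c.+1)) * (2 * r).+1)).
- exact: cf_const.
- exact: cf_nth.
apply: cf_mul; last by apply: cf_succ; apply: cf_mul; [exact: cf_const | exact: cf_nth].
apply: cf_exp; first exact: cf_const.
apply: cf_odd; apply: cf_div; first exact: (cf_nthb 2).
apply: cf_exp; first exact: cf_const.
by apply: cf_sub; [exact: (cf_nthb 2) | apply: cf_succ; exact: cf_nth].
Qed.

(** * Trees and finite counting *)

Definition unbits (s : seq bool) : nat := foldr (fun (b : bool) n => b + n.*2) 0 s.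

Lemma unbits_bits k i : unbits (bits k i) = i %% 2 ^ k.
Proof.
elim: k i => [|k IH] i /=; first by rewrite modn1.
rewrite IH; set r := _ %% _; have ltr : r < 2 ^ k by rewrite ltn_mod expn_gt0.
have E : i = i./2 %/ 2 ^ k * 2 ^ k.+1 + (odd i + r.*2).
  have := odd_double_half i; have := divn_eq i./2 (2 ^ k); rewrite -/r expnS; lia.
by rewrite [X in _ = X %% _]E modnMDl modn_small // expnS; case: (odd i); lia.
Qed.

Lemma bits_unbits k s : k <= size s -> bits k (unbits s) = take k s.
Proof.
elim: s k => [|b s IH] [|k] //= lek; rewrite oddD odd_double addbF oddb.
by congr (_ :: _); rewrite -IH // halfD odd_double andbF doubleK; case: b.
Qed.

Lemma bits_mod k i j : i = j %[mod 2 ^ k] <-> bits k i = bits k j.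
Proof.
split; last by move=> E; rewrite -!unbits_bits E.
suff bitsm x : bits k x = bits k (x %% 2 ^ k) by rewrite (bitsm i) (bitsm j) => ->.
by rewrite -unbits_bits bits_unbits ?take_oversize ?size_bits.
Qed.

Lemma eq_mod_pow2 k n i j : k <= n -> i = j %[mod 2 ^ n] -> i = j %[mod 2 ^ k].
Proof.
by move=> lekn E; rewrite -(modn_dvdm i (dvdn_exp2l 2 lekn)) E modn_dvdm // dvdn_exp2l.
Qed.

Definition zp (Z : real) (k : nat) : nat := unbits (mkseq Z k).

Lemma bits_zp Z k t : k <= t -> bits k (zp Z t) = mkseq Z k.
Proof. by move=> le; rewrite bits_unbits ?size_mkseq // /mkseq -map_take take_iota (minn_idPl le). Qed.

Lemma zp_mod Z k t : k <= t -> zp Z t = zp Z k %[mod 2 ^ k].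
Proof. by move=> le; apply/bits_mod; rewrite !bits_zp. Qed.

Lemma prefix_of_mkseq s Z : prefix_of s Z <-> s = mkseq Z (size s).
Proof.
split=> [H|E i lti]; last by rewrite E nth_mkseq.
apply: (@eq_from_nth _ false); first by rewrite size_mkseq.
by move=> i lti; rewrite nth_mkseq // H.
Qed.

Lemma prefix_of_bits k i Z : prefix_of (bits k i) Z <-> zp Z k = i %[mod 2 ^ k].
Proof.
rewrite prefix_of_mkseq size_bits.
by split=> [E|/bits_mod]; [apply/bits_mod|]; rewrite bits_zp.
Qed.

Lemma prefix_str_bits s n x : prefix_str s (bits n x) <-> size s <= n /\ s = bits (size s) x.
Proof.
rewrite /prefix_str size_bits; split=> -[le H]; split=> //.
  apply: (@eq_from_nth _ false); first by rewrite size_bits.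
  by move=> i lti; rewrite H // !nth_bits // (leq_trans lti).
by move=> i lti; rewrite {1}H !nth_bits // (leq_trans lti).
Qed.

Definition per (k : nat) (Q : pred nat) := forall i j, i = j %[mod 2 ^ k] -> Q i = Q j.

(** When [per n Q] holds, this is 2^n times the measure of the clopen set coded by [Q]. *)
Definition card (Q : pred nat) (n : nat) : nat := count Q (iota 0 (2 ^ n)).

Lemma card_sub (Q Q' : pred nat) n : (forall x, Q x -> Q' x) -> card Q n <= card Q' n.
Proof. by move=> H; apply: sub_count. Qed.

Lemma card_le Q n : card Q n <= 2 ^ n.
Proof. by rewrite -[X in _ <= X](size_iota 0); exact: count_size. Qed.

Lemma card_per Q k n : k <= n -> per k Q -> card Q n = 2 ^ (n - k) * card Q k.
Proof.
move=> lekn perQ; rewrite -{1}(subnKC lekn); elim: (n - k) => [|d IH]; first by rewrite addn0 mul1n.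
rewrite addnS {1}/card expnS mul2n -addnn iotaD count_cat -/(card Q _) IH.
(* The upper half of the range is the lower half shifted by a multiple of 2^k, which [Q] does not
   see. *)
rewrite add0n -[X in iota X](addn0) iotaDl count_map.
rewrite (eq_count (a2 := Q)); last first.
  by move=> i /=; apply: perQ; rewrite expnD mulnC modnMDl.
by rewrite -/(card Q _) IH addnn -mul2n expnS mulnA.
Qed.

Lemma card_split Q m n : card Q n = \sum_(r < 2 ^ m) card (fun x => Q x && (x == r %[mod 2 ^ m])) n.
Proof.
rewrite /card -sum1_count.
rewrite (partition_big (fun x => Ordinal (ltn_pmod x (expn_gt0 2 m))) predT) //=.
apply: eq_bigr => r _; rewrite sum1_count; apply: eq_count => x /=.
by rewrite -val_eqE /= (modn_small (ltn_ord r)).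
Qed.

Lemma geometric_sum_bound N (x : nat -> nat) b :
  (forall j, j < N -> x j * 2 ^ j.+1 <= b) -> \sum_(0 <= j < N) x j <= b.
Proof.
(* The sharper bound (1 - 2^-N) b, cleared of denominators, is what the induction can carry. *)
move=> H; suff : 2 ^ N * \sum_(0 <= j < N) x j + b <= 2 ^ N * b.
  by rewrite -[2 ^ N]prednK ?expn_gt0 // mulSn; nia.
elim: N H => [|N IH] H; first by rewrite big_geq // muln0 !mul1n.
rewrite big_nat_recr //= expnS.
have {}IH := IH (fun j ltj => H j (leqW ltj)).
have := H N (leqnn _); rewrite expnS; nia.
Qed.

Lemma count_has_sum (T : eqType) N (Q : nat -> pred T) (s : seq T) :
  count (fun x => has (Q ^~ x) (iota 0 N)) s <= \sum_(0 <= l < N) count (Q l) s.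
Proof.
elim: N => [|N IH]; first by rewrite count_pred0.
rewrite big_nat_recr //; apply: leq_trans (leq_add IH (leqnn _)).
rewrite -count_predUI; apply: leq_trans (leq_addr _ _); apply: sub_count => x.
by rewrite -(addn1 N) iotaD has_cat /= add0n orbF.
Qed.

Definition istree (A : nat -> nat -> bool) : Prop :=
  (forall t, per t (A t)) /\ (forall t k i, k <= t -> A t i -> A k i).

(** For a tree, this is 2^t times the measure that level [t] leaves in the cylinder of the string of
    length [k] coded by [j], if [k <= t]. *)
Definition cnt (A : nat -> nat -> bool) (t k j : nat) : nat :=
  card (fun i => A t i && (i == j %[mod 2 ^ k])) t.

Lemma cnt_mod A t k i j : i = j %[mod 2 ^ k] -> cnt A t k i = cnt A t k j.
Proof. by move=> E; apply: eq_count => x; rewrite E. Qed.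

Lemma cnt_decr A t s k i : istree A -> k <= s -> s <= t -> cnt A t k i <= 2 ^ (t - s) * cnt A s k i.
Proof.
move=> [perA monoA] leks lest; rewrite /cnt -[in X in _ <= X]card_per //; last first.
  by move=> x y E; rewrite (perA _ _ _ E) (eq_mod_pow2 leks E).
by apply: card_sub => x /andP[/(monoA _ _ _ lest) -> ->].
Qed.

(** The measures of the levels of a tree decrease, so a common lower bound 2^-q is a lower bound for
    the measure of its set of paths. *)
Definition pos (A : nat -> nat -> bool) : Prop :=
  exists q, forall t, q <= t -> 2 ^ t <= card (A t) t * 2 ^ q.

(** For a tree, by compactness, this says that the node [j] of level [l] lies on a path. *)
Definition ext (A : nat -> nat -> bool) (l j : nat) : Prop :=
  forall t, l <= t -> exists i, A t i && (i == j %[mod 2 ^ l]).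

(** The bound depends on the level [k] only and holds at all later stages [t], so it passes to the
    measure of the paths through an extendible node. *)
Definition fat (A : nat -> nat -> bool) : Prop :=
  exists h : nat -> nat, forall t k i, k <= t -> A t i -> 2 ^ t <= cnt A t k i * 2 ^ h k.

Definition path (A : nat -> nat -> bool) (Z : real) : Prop := forall t, A t (zp Z t).

Lemma path_ext A Z l : path A Z -> ext A l (zp Z l).
Proof. by move=> pZ t le; exists (zp Z t); rewrite pZ zp_mod /=. Qed.

Lemma ext_mod A l i j : i = j %[mod 2 ^ l] -> ext A l i -> ext A l j.
Proof. by move=> E H t /H[x]; rewrite E => Hx; exists x. Qed.

(** A level has finitely many nodes, and each non-extendible one loses all its extensions at some
    stage; the maximum of these stages serves. *)
Lemma dead_stage A k : istree A ->
  exists2 T, k <= T & forall j t i, ~ ext A k j -> T <= t -> A t i -> i <> j %[mod 2 ^ k].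
Proof.
move=> [perA monoA].
have /(fun H j => constructive_indefinite_description _ (H j)) f : forall j, exists t,
    ~ ext A k j -> k <= t /\ forall i, A t i -> i <> j %[mod 2 ^ k].
  move=> j; case: (classic (ext A k j)) => [?|]; first by exists 0.
  move=> /not_all_ex_not[t Ht]; exists t => _; split; first by apply: NNPP => nle; apply: Ht.
  by move=> i Ai Eij; apply: Ht => _; exists i; rewrite Ai Eij /=.
exists (maxn k (\max_(j < 2 ^ k) sval (f j))); first exact: leq_maxl.
move=> j t i next leTt Ai Eij.
pose r := Ordinal (ltn_pmod j (expn_gt0 2 k)).
have Er : r = j %[mod 2 ^ k] by rewrite modn_mod.
have [|lek] := svalP (f r); first by move=> /(ext_mod Er).
move=> /(_ i); apply; last by rewrite Eij Er.
apply: monoA Ai; apply: leq_trans leTt; rewrite leq_max; apply/orP; right.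
exact: (leq_bigmax r).
Qed.

(** A node of level [k] that still has extensions at the stage given by [dead_stage] is
    extendible. *)
Lemma ext_extend A l j k : istree A -> ext A l j -> l <= k ->
  exists2 i, i = j %[mod 2 ^ l] & ext A k i.
Proof.
move=> trA extj lelk; have [T lekT HT] := dead_stage k trA.
have [i /andP[Ai /eqP Eij]] := extj T (leq_trans lelk lekT).
exists i => //; apply: NNPP => next; exact: (HT i T i next).
Qed.

Lemma ext_sat A t i : istree A -> ext A t i -> A t i.
Proof. by move=> [perA _] /(_ t (leqnn t))[x /andP[Ax /eqP E]]; rewrite -(perA t _ _ E). Qed.

(** * Computable trees of positive measure *)

Ltac cf_step := lazymatch goal with
  | |- cf _ (fun v => nat_of_bool (all _ (iota 0 _))) => apply: cb_all
  | |- cf _ (fun v => nat_of_bool (has _ (iota 0 _))) => apply: cb_has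
  | |- cf _ (fun v => count _ (iota 0 _)) => apply: cf_count
  | |- cf _ (fun v => nat_of_bool (_ && _)) => apply: cb_and
  | |- cf _ (fun v => nat_of_bool (_ || _)) => apply: cb_or
  | |- cf _ (fun v => nat_of_bool (~~ _)) => apply: cb_neg
  | |- cf _ (fun v => nat_of_bool (_ <= _)) => apply: cb_leq
  | |- cf _ (fun v => nat_of_bool (_ == _)) => apply: cb_eq
  | |- cf _ (fun v => _ + _) => apply: cf_add
  | |- cf _ (fun v => _ - _) => apply: cf_sub
  | |- cf _ (fun v => _ * _) => apply: cf_mul
  | |- cf _ (fun v => _ ^ _) => apply: cf_exp
  | |- cf _ (fun v => _ %/ _) => apply: cf_div
  | |- cf _ (fun v => _ %% _) => apply: cf_mod
  | |- cf _ (fun v => _.+1) => apply: cf_succ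
  | |- cf _ (fun v => nth 0 v _) => exact: cf_nth
  | |- cf _ (fun v => nth 0 (behead v) _) => exact: (cf_nthb 1)
  | |- cf _ (fun v => nth 0 (behead (behead v)) _) => exact: (cf_nthb 2)
  | |- cf _ (fun v => nth 0 (behead (behead (behead v))) _) => exact: (cf_nthb 3)
  | |- cf _ (fun v => _) => exact: cf_const
  end.
Ltac cf_tac := repeat cf_step.

Definition ctree (A : nat -> nat -> bool) : Prop := istree A /\ C2 (fun t i => A t i).

(** Levels below [l] stay untouched, since the first [t < l] bits do not determine a residue modulo
    2^l. *)
Definition restr A l j : nat -> nat -> bool :=
  fun t i => A t i && ((t < l) || (i == j %[mod 2 ^ l])).

Lemma restr_ctree A l j : ctree A -> ctree (restr A l j).
Proof.
move=> [[perA monoA] cA]; split; last first.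
  by apply: cb_and; [exact: cA | cf_tac].
split=> [t x y E | t k i lekt] /=.
  by rewrite /restr (perA _ _ _ E); case: (ltnP t l) => //= le; rewrite (eq_mod_pow2 le E).
move=> /andP[/(monoA _ _ _ lekt) Ak H]; rewrite /restr Ak.
by case: (ltnP t l) H => [/(leq_ltn_trans lekt) -> | _ /= ->]; rewrite ?orbT.
Qed.

Lemma path_restr A l j Z : path (restr A l j) Z -> path A Z /\ zp Z l = j %[mod 2 ^ l].
Proof.
move=> pZ; split=> [t|]; first by case/andP: (pZ t).
by case/andP: (pZ l); rewrite ltnn => _ /eqP.
Qed.

Lemma restr_pos A l j : ctree A -> fat A -> ext A l j -> pos (restr A l j).
Proof.
(* Fatness gives the mass 2^-h(l); the summand [l] ensures [l <= t]. *)
move=> _ [h fatA] extj; exists (h l + l) => t le; have lelt : l <= t by lia.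
have [i /andP[Ai /eqP Eij]] := extj t lelt.
apply: leq_trans (fatA t l i lelt Ai) _; rewrite (cnt_mod _ _ Eij) leq_mul ?leq_pexp2l ?leq_addr //.
by apply: card_sub => x /andP[Ax Ex]; rewrite /restr Ax Ex orbT.
Qed.

(** The open set takes at most half of the guaranteed mass 2^-m, so at least 2^-(m+1) is left. *)
Lemma avoid_ce_open A m e : ctree A -> (forall t, m < t -> 2 ^ t <= card (A t) t * 2 ^ m) ->
  measure_le_pow2 (W e) m.+1 ->
  exists A', [/\ ctree A', pos A', forall t i, A' t i -> A t i &
    forall Z, path A' Z -> ~ opengen (W e) Z].
Proof.
move=> [[perA monoA] cA] posA We; have [E [cE monoE HE]] := exists_approx (prog e) 1.
(* Level [t] respects only prefixes of length at most [t] enumerated by stage [t], which keeps the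
   tree computable. *)
pose B t i := all (fun k => E t [:: pickle (bits k i)] == 0) (iota 0 t.+1).
exists (fun t i => A t i && B t i); split.
- split; last first.
    apply: cb_and; first exact: cA.
    apply: (cb_all (N := fun v => (nth 0 v 0).+1)
      (Q := fun k v => E (nth 0 v 0) [:: pickle (bits k (nth 0 v 1))] == 0)); first by cf_tac.
    apply: cb_eq; last exact: cf_const.
    apply: (cf_comp cE (cfs_cons (cf_nthb 1 _ 0) (cfs_cons _ (cfs_nil _)))).
    by apply: (C2_comp C2_pickle_bits); [exact: cf_nth | exact: (cf_nthb 1)].
  split=> [t i j Eij|t k i lekt /andP[/(monoA _ _ _ lekt) -> /allP Bt]] /=.
    rewrite (perA _ _ _ Eij); congr (_ && _); apply: eq_in_all => k.
    rewrite mem_iota add0n ltnS => /= lekt.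
    by rewrite ((bits_mod k i j).1 (eq_mod_pow2 lekt Eij)).
  apply/allP => n; rewrite mem_iota add0n => /= len.
  have := Bt n; rewrite mem_iota add0n => /(_ (leq_trans len (lekt : k < t.+1)))/eqP E0.
  by case E1 : (E k _) => [|y] //; rewrite (monoE _ _ _ _ lekt E1) in E0.
- exists m.+1 => t lt; have := posA t lt.
  pose L := [seq bits t x | x <- [seq x <- iota 0 (2 ^ t) | A t x && ~~ B t x]].
  have : size L * 2 ^ m.+1 <= 2 ^ t.
    apply: We.
    + rewrite map_inj_in_uniq ?filter_uniq ?iota_uniq // => x y.
      rewrite !mem_filter !mem_iota !add0n => /andP[_ ltx] /andP[_ lty] /bits_mod.
      by rewrite !modn_small.
    + by move=> s /mapP[x _ ->]; rewrite size_bits.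
    + move=> s /mapP[x]; rewrite mem_filter => /andP[/andP[_ /allPn[k]]].
      rewrite mem_iota ltnS => /= lekt; case Ek : (E _ _) => [|y] // _ _ ->.
      exists (bits k x); split; first by exists y; apply/HE => //; exists t.
      by apply/prefix_str_bits; rewrite size_bits.
  have -> : card (A t) t = card (fun x => A t x && B t x) t + size L.
    rewrite size_map size_filter /card.
    have := count_predC (B t) [seq x <- iota 0 (2 ^ t) | A t x].
    rewrite !count_filter size_filter => <-.
    by congr (_ + _); apply: eq_count => x /=; rewrite andbC.
  rewrite expnS; nia.
- by move=> t i /andP[].
- move=> Z pZ [s [[y /(HE [:: pickle s] _ erefl)[t Et]] /prefix_of_mkseq Es]].
  have /andP[_ /allP /(_ (size s))] := pZ (maxn (size s) t).
  rewrite mem_iota ltnS leq_maxl => /(_ isT); rewrite bits_zp ?leq_maxl // -Es.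
  by rewrite (monoE _ _ _ _ (leq_maxr _ _) Et).
Qed.

Lemma C3_cnt (A : nat -> nat -> bool) : C2 (fun t i => A t i) -> C3 (cnt A).
Proof.
move=> cA; apply: (cf_count (N := fun v => 2 ^ nth 0 v 0)
  (Q := fun x v => A (nth 0 v 0) x && (x == nth 0 v 2 %[mod 2 ^ nth 0 v 1]))); first by cf_tac.
by apply: cb_and; [apply: (C2_comp cA) |]; cf_tac.
Qed.

(** There are 2^m cylinders of level [m], and each thin one contributes at most 2^t / E. *)
Lemma card_thin A t m E : istree A -> m <= t ->
  card (fun x => A t x && (cnt A t m x * E < 2 ^ t)) t * E <= 2 ^ m * 2 ^ t.
Proof.
move=> [perA monoA] lemt; rewrite (card_split _ m) big_distrl /=.
apply: leq_trans (_ : \sum_(r < 2 ^ m) 2 ^ t <= _); last by rewrite sum_nat_const card_ord.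
apply: leq_sum => r _; case: (ltnP (cnt A t m r * E) (2 ^ t)) => [/ltnW|] thin.
  apply: leq_trans thin; rewrite leq_mul2r; apply/orP; right.
  by apply: card_sub => x /andP[/andP[-> _] ->].
rewrite /card (eq_count (a2 := pred0)) ?count_pred0 // => x /=.
case: eqP => Ex; last by rewrite andbF.
by rewrite (cnt_mod _ _ Ex) ltnNge thin andbF.
Qed.

(** Removing the thin nodes of level m costs at most 2^(m - (m+2)^2 - c). The losses at all levels
    above k have to sum to at most half of the threshold at level k, so consecutive exponents must
    differ by more than the level; hence the square. *)
Definition prune A c : nat -> nat -> bool := fun t i =>
  A t i && all (fun k => 2 ^ t <= cnt A t k i * 2 ^ (k.+2 * k.+2 + c)) (iota 0 t.+1).

Lemma prune_ctree A c : ctree A -> ctree (prune A c).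
Proof.
move=> [trA cA]; have [perA monoA] := trA; split; last first.
  apply: cb_and; first exact: cA.
  apply: (cb_all (N := fun v => (nth 0 v 0).+1)
    (Q := fun k v => 2 ^ nth 0 v 0 <= cnt A (nth 0 v 0) k (nth 0 v 1) * 2 ^ (k.+2 * k.+2 + c))).
    by cf_tac.
  apply: cb_leq; first by cf_tac.
  by apply: cf_mul; [apply: (C3_comp (C3_cnt cA)) |]; cf_tac.
split=> [t i j Eij|t s i lest /andP[/(monoA _ _ _ lest) As /allP Ht]] /=.
  rewrite /prune (perA _ _ _ Eij); congr (_ && _); apply: eq_in_all => k.
  rewrite mem_iota add0n ltnS => /= lekt.
  by rewrite (cnt_mod _ _ (eq_mod_pow2 lekt Eij)).
rewrite /prune As; apply/allP => k; rewrite mem_iota add0n ltnS => /= leks.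
have := Ht k; rewrite mem_iota add0n ltnS => /(_ (leq_trans leks lest)).
move=> Hk; rewrite -(leq_pmul2l (expn_gt0 2 (t - s))) -expnD subnK //.
by apply: leq_trans Hk _; rewrite mulnA leq_mul2r cnt_decr ?orbT.
Qed.

Lemma pow2_cancel x y a c e : x * 2 ^ e <= 2 ^ a * y -> c + a <= e -> x * 2 ^ c <= y.
Proof.
move=> H le; rewrite -(leq_pmul2l (expn_gt0 2 a)); apply: leq_trans H.
by rewrite mulnCA leq_mul2l -expnD addnC leq_pexp2l ?orbT.
Qed.

(* The mass removed by [prune] inside the set [P] comes from the levels [m >= n] only. *)
Lemma prune_loss A c t n (P : pred nat) b : istree A ->
  (forall x m, P x -> m < n -> m <= t -> 2 ^ t <= cnt A t m x * 2 ^ (m.+2 * m.+2 + c)) ->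
  (forall m, n <= m -> b + (m - n).+1 + m <= m.+2 * m.+2 + c) ->
  card (fun x => A t x && P x) t * 2 ^ b <=
    card (fun x => prune A c t x && P x) t * 2 ^ b + 2 ^ t.
Proof.
move=> trA HP Hb.
pose R m := card (fun x => A t x && (cnt A t m x * 2 ^ (m.+2 * m.+2 + c) < 2 ^ t)) t.
have HR : (\sum_(0 <= j < t.+1 - n) R (n + j)) * 2 ^ b <= 2 ^ t.
  rewrite big_distrl /=; apply: geometric_sum_bound => j ltj.
  have := card_thin (2 ^ ((n + j).+2 * (n + j).+2 + c)) trA (_ : n + j <= t).
  rewrite -/(R (n + j)) => /(_ ltac:(lia)).
  have := Hb (n + j) (leq_addr _ _); rewrite addKn => le /pow2_cancel-/(_ _ le).
  by rewrite expnD mulnA.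
apply: leq_trans (leq_add (leqnn _) HR); rewrite -mulnDl leq_mul2r; apply/orP; right.
apply: leq_trans (leq_add (leqnn _) (count_has_sum _ _ _)).
rewrite /card -count_predUI; apply: leq_trans (leq_addr _ _); apply: sub_count => x /andP[Ax Px].
apply/orP; rewrite /prune Ax Px andbT andTb.
case: (boolP (all _ _)) => [_|/allPn[k]]; first by left.
rewrite mem_iota add0n ltnS => /= lekt; rewrite -ltnNge => thin; right; apply/hasP.
have lenk : n <= k by rewrite leqNgt; apply/negP => ltkn; move: thin; rewrite ltnNge HP.
by exists (k - n); [rewrite mem_iota; lia | rewrite subnKC // Ax].
Qed.

(** With e = (k+2)^2 + c, the cylinder of a surviving [i] at level [k] has mass at least 2^-e in
    [A]. As [i] also passes the thresholds of the smaller levels, pruning inside this cylinder acts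
    above level [k] only and costs at most 2^-(e+1). *)
Lemma prune_fat A c : istree A -> fat (prune A c).
Proof.
move=> trA; exists (fun k => (k.+2 * k.+2 + c).+1) => t k i lekt Ai.
have /andP[_ /allP Hi] := Ai.
have Hk m : m <= t -> 2 ^ t <= cnt A t m i * 2 ^ (m.+2 * m.+2 + c).
  by move=> le; apply: Hi; rewrite mem_iota add0n ltnS.
have := prune_loss (c := c) (t := t) (n := k.+1) (P := fun x => x == i %[mod 2 ^ k])
  (b := (k.+2 * k.+2 + c).+1) trA.
rewrite -/(cnt A t k i) -/(cnt (prune A c) t k i).
have := Hk k lekt; rewrite expnS => H1 H2.
suff : cnt A t k i * (2 * 2 ^ (k.+2 * k.+2 + c)) <= cnt (prune A c) t k i * (2 * 2 ^ (k.+2 * k.+2 + c)) + 2 ^ t.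
  by lia.
apply: H2 => [x m /eqP Ex ltm lem|m ltm]; last by nia.
by rewrite (cnt_mod A t (eq_mod_pow2 (_ : m <= k) Ex)) ?Hk.
Qed.

(** For [c = q] all levels together cost at most 2^-(q+1), half of the guaranteed mass. *)
Lemma prune_pos A : istree A -> pos A -> exists c, pos (prune A c).
Proof.
move=> trA [q posA]; exists q; exists q.+1 => t ltq.
have := prune_loss (c := q) (t := t) (n := 0) (P := predT) (b := q.+1) trA.
have cardT Q : card (fun x => Q x && predT x) t = card Q t by apply: eq_count => x; rewrite andbT.
rewrite !cardT => /(_ _ _)H; have := posA t (ltnW ltq); rewrite expnS in H *.
suff : card (A t) t * (2 * 2 ^ q) <= card (prune A q t) t * (2 * 2 ^ q) + 2 ^ t by lia.
by apply: H => // m _; nia.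
Qed.

(** * A Demuth test dense in a computable tree *)

(* Two stages with the same version number differ in measure by less than 2^-(m+2). *)
Definition ver (A : nat -> nat -> bool) (m t : nat) : nat := card (A t) t * 2 ^ m.+2 %/ 2 ^ t.

(* The length 2l+m+2 makes the 2^l strings selected at level [l] weigh at most 2^-(l+m+2) together. *)
Definition lead (A : nat -> nat -> bool) (m t l i : nat) : bool :=
  all (fun j => ~~ (j == i %[mod 2 ^ l]) || (cnt A t (2 * l + m.+2) j == 0))
    (iota 0 (i %% 2 ^ (2 * l + m.+2))).

(** These are the strings that stage [t] adds to the current version of the [m]-th component. *)
Definition cov (A : nat -> nat -> bool) (m t i : nat) : bool :=
  A t i && has (fun l => (2 * l + m.+2 <= t) && lead A m t l i) (iota 0 t).

(** The value lies between (m+v)^2 and (m+v)^2 + (m+v), so m+v is its integer square root. *)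
Definition npair (m v : nat) : nat := (m + v) * (m + v) + m.

Lemma npair_inj m v m' v' : npair m v = npair m' v' -> m = m' /\ v = v'.
Proof.
rewrite /npair => E; have : m + v = m' + v' by case: (ltngtP (m + v) (m' + v')); nia.
by move=> E'; rewrite E' in E; lia.
Qed.

Lemma C2_ver (A : nat -> nat -> bool) : C2 (fun t i => A t i) -> C2 (ver A).
Proof.
move=> cA; apply: cf_div; last by cf_tac.
apply: cf_mul; last by cf_tac.
apply: (cf_count (N := fun v => 2 ^ nth 0 v 1) (Q := fun i v => A (nth 0 v 1) i)); first by cf_tac.
by apply: (C2_comp cA); cf_tac.
Qed.

Lemma C4_lead (A : nat -> nat -> bool) : C2 (fun t i => A t i) -> C4 (fun m t l i => lead A m t l i).
Proof.
move=> cA; apply: (cb_all (N := fun v => nth 0 v 3 %% 2 ^ (2 * nth 0 v 2 + (nth 0 v 0).+2))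
  (Q := fun j v => ~~ (j == nth 0 v 3 %[mod 2 ^ nth 0 v 2]) ||
    (cnt A (nth 0 v 1) (2 * nth 0 v 2 + (nth 0 v 0).+2) j == 0))); first by cf_tac.
apply: cb_or; first by cf_tac.
by apply: cb_eq; [apply: (C3_comp (C3_cnt cA)) |]; cf_tac.
Qed.

Lemma C3_cov (A : nat -> nat -> bool) : C2 (fun t i => A t i) -> C3 (fun m t i => cov A m t i).
Proof.
move=> cA; apply: cb_and; first by apply: (C2_comp cA); cf_tac.
apply: (cb_has (N := fun v => nth 0 v 1) (Q := fun l v => (2 * l + (nth 0 v 0).+2 <= nth 0 v 1) &&
  lead A (nth 0 v 0) (nth 0 v 1) l (nth 0 v 2))); first by cf_tac.
by apply: cb_and; last apply: (C4_comp (C4_lead cA)); cf_tac.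
Qed.

Lemma cnt_gt0 A t k y : istree A -> k <= t -> A t y -> 0 < cnt A t k y.
Proof.
move=> [perA _] lekt Ay; rewrite /cnt /card -has_count; apply/hasP; exists (y %% 2 ^ t).
  by rewrite mem_iota add0n /= ltn_mod expn_gt0.
rewrite (perA t _ y) ?modn_mod // Ay /=.
by apply/eqP; apply: (eq_mod_pow2 lekt); rewrite modn_mod.
Qed.

Lemma per_lead A m t l x y : x = y %[mod 2 ^ (2 * l + m.+2)] -> lead A m t l x = lead A m t l y.
Proof.
move=> E; rewrite /lead E; apply: eq_all => j.
by rewrite (eq_mod_pow2 (_ : l <= 2 * l + m.+2) E) //; lia.
Qed.

Lemma per_cov A m t : istree A -> per t (cov A m t).
Proof.
move=> [perA _] x y E; rewrite /cov (perA t _ _ E); congr (_ && _); apply: eq_has => l.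
by case: leqP => //= le; apply: per_lead; exact: eq_mod_pow2 E.
Qed.

Lemma version_index (A : nat -> nat -> bool) : ctree A -> exists idx, C1 idx /\
  forall m v s, W (idx (npair m v)) s <-> exists t i, [/\ s = bits t i, ver A m t = v & cov A m t i].
Proof.
move=> [trA cA].
(* Since [m <= npair m v], the first coordinate of [n] is found among the numbers up to [n]. *)
pose D t x n := has (fun i => (pickle (bits t i) == x) &&
  has (fun m => (npair m (ver A m t) == n) && cov A m t i) (iota 0 n.+1)) (iota 0 (2 ^ t)).
have cD : C3 (fun t x n => D t x n).
  apply: (cb_has (N := fun v => 2 ^ nth 0 v 0) (Q := fun i v => (pickle (bits (nth 0 v 0) i) == nth 0 v 1) &&
    has (fun m => (npair m (ver A m (nth 0 v 0)) == nth 0 v 2) && cov A m (nth 0 v 0) i)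
      (iota 0 (nth 0 v 2).+1))); first by cf_tac.
  apply: cb_and.
    by apply: cb_eq; [apply: (C2_comp C2_pickle_bits) |]; cf_tac.
  apply: (cb_has (N := fun v => (nth 0 (behead v) 2).+1) (Q := fun m v =>
    (npair m (ver A m (nth 0 (behead v) 0)) == nth 0 (behead v) 2) &&
    cov A m (nth 0 (behead v) 0) (nth 0 v 0))); first by cf_tac.
  apply: cb_and; last by apply: (C3_comp (C3_cov cA)); cf_tac.
  apply: cb_eq; last by cf_tac.
  have cv : cf 5 (fun w => ver A (nth 0 w 0) (nth 0 (behead (behead w)) 0)).
    by apply: (C2_comp (C2_ver cA)); cf_tac.
  apply: cf_add; last by cf_tac.
  by apply: cf_mul; apply: cf_add; try exact: cv; cf_tac.
have [idx [cidx Hidx]] := search_index cD; exists idx; split=> // m v s; rewrite Hidx; split.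
  case=> t /hasP[i _ /andP[/eqP/(pcan_inj pickleK) <- /hasP[m' _ /andP[/eqP/npair_inj[-> Ev] c]]]].
  by exists t, i.
case=> t [i [-> Ev c]]; exists t; apply/hasP; exists (i %% 2 ^ t).
  by rewrite mem_iota add0n /= ltn_mod expn_gt0.
rewrite ((bits_mod t (i %% 2 ^ t) i).1) ?modn_mod // eqxx andTb; apply/hasP; exists m.
  by rewrite mem_iota add0n ltnS /npair; nia.
by rewrite Ev eqxx (per_cov m trA (_ : i %% 2 ^ t = i %[mod 2 ^ t])) ?modn_mod.
Qed.

Lemma ver_decr A m s t : istree A -> s <= t -> ver A m t <= ver A m s.
Proof.
move=> trA lest; rewrite /ver -[in X in X <= _](subnK lest) expnD.
rewrite -(@divnMl (2 ^ (t - s)) _ (2 ^ s)) ?expn_gt0 //; apply: leq_div2r.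
rewrite mulnA leq_mul2r; apply/orP; right; rewrite subnK //.
rewrite -card_per //; last exact: trA.1.
by apply: card_sub => x; exact: trA.2.
Qed.

Lemma lead_mono A m s t l i : istree A -> 2 * l + m.+2 <= s -> s <= t ->
  lead A m s l i -> lead A m t l i.
Proof.
move=> trA les lest /allP H; apply/allP => j /H /orP[->//|/eqP c0]; apply/orP; right.
by rewrite -leqn0; apply: leq_trans (cnt_decr j trA les lest) _; rewrite c0 muln0.
Qed.

(** The string [y] keeps its own node of length 2l+m+2 alive; were this node smaller than that of
    [x], it would refute that [x] leads. *)
Lemma lead_uniq A m t l x y : istree A -> 2 * l + m.+2 <= t -> A t y ->
  lead A m t l x -> x = y %[mod 2 ^ l] -> x %% 2 ^ (2 * l + m.+2) <= y %% 2 ^ (2 * l + m.+2).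
Proof.
move=> trA le Ay /allP lx E; rewrite leqNgt; apply/negP => lt.
have := lx (y %% 2 ^ (2 * l + m.+2)); rewrite mem_iota add0n => /(_ lt).
rewrite (@cnt_mod A t _ _ y) ?modn_mod // -leqn0 leqNgt cnt_gt0 // orbF.
by rewrite modn_dvdm ?E ?eqxx // dvdn_exp2l // mul2n -addnn -addnA leq_addr.
Qed.

(** By [lead_uniq] the first [l] bits of a leading string in [A t] determine its first 2l+m+2 bits.
    So the map [f], which keeps the first [l] bits and the bits beyond 2l+m+2, is injective. *)
Lemma lead_card A m t l n : istree A -> 2 * l + m.+2 <= t -> t <= n ->
  card (fun x => A t x && lead A m t l x) n * 2 ^ (l + m.+2) <= 2 ^ n.
Proof.
move=> trA le len; set L := 2 * l + m.+2; set Q := fun x => _.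
pose f x := x %/ 2 ^ L * 2 ^ l + x %% 2 ^ l.
suff sz : card Q n <= 2 ^ (n - L + l).
  apply: leq_trans (_ : 2 ^ (n - L + l) * 2 ^ (l + m.+2) <= _); first by rewrite leq_mul2r sz orbT.
  by rewrite -expnD leq_pexp2l // /L; lia.
rewrite /card -size_filter -(size_map f) -[X in _ <= X](size_iota 0).
apply: uniq_leq_size.
  rewrite map_inj_in_uniq ?filter_uniq ?iota_uniq // => x y.
  rewrite !mem_filter => /andP[/andP[Ax lx] _] /andP[/andP[Ay ly] _] Ef.
  have E : x = y %[mod 2 ^ l] by rewrite -[LHS]modn_mod -(modnMDl (x %/ 2 ^ L)) -/(f x) Ef modnMDl modn_mod.
  have Eq : x %/ 2 ^ L = y %/ 2 ^ L.
    have := Ef; rewrite /f E => /addIn/eqP.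
    by rewrite eqn_pmul2r ?expn_gt0 // => /eqP.
  rewrite (divn_eq x (2 ^ L)) (divn_eq y (2 ^ L)) Eq; congr (_ + _); apply/eqP.
  rewrite eqn_leq; apply/andP; split.
    exact: (lead_uniq trA le Ay lx E).
  exact: (lead_uniq trA le Ax ly (esym E)).
move=> y /mapP[x]; rewrite mem_filter !mem_iota !add0n => /andP[_ ltx] ->.
rewrite /f addnC /= expnD.
have H1 : x %% 2 ^ l < 2 ^ l by rewrite ltn_mod expn_gt0.
have H2 : x %/ 2 ^ L < 2 ^ (n - L) by rewrite ltn_divLR ?expn_gt0 // -expnD subnK //; lia.
nia.
Qed.

(** Let [s] and [T] be the first and last stages up to [n] with version [v]. Covered strings still
    in [A T] lead at stage [T] and weigh at most the sum of the 2^-(l+m+2), that is 2^-(m+1). The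
    others were lost between [s] and [T], and weigh at most 2^-(m+2) because the version is the
    same. *)
Lemma version_measure A m v : istree A ->
  measure_le_pow2 (fun s => exists t i, [/\ s = bits t i, ver A m t = v & cov A m t i]) m.
Proof.
move=> trA n L uL szL HL; have [perA monoA] := trA.
(* Stage [t] contributes strings of length [t], so only stages up to [n] can supply prefixes of
   strings of length [n]. *)
pose Y x := has (fun t => (ver A m t == v) && cov A m t x) (iota 0 n.+1).
have leL : size L <= card Y n.
  rewrite -(size_map unbits L) /card -size_filter; apply: uniq_leq_size.
    rewrite map_inj_in_uniq // => s s' /szL szs /szL szs' E.
    rewrite -(take_size s) -(take_size s') szs szs' -bits_unbits ?szs // -bits_unbits ?szs' //.
    by rewrite E.
  move=> x /mapP[s Ls ->]; rewrite mem_filter mem_iota add0n /=; apply/andP; split; last first.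
    rewrite -[s]take_size szL // -bits_unbits ?szL // unbits_bits ltn_mod expn_gt0.
    by [].
  have [_ [[t [i [-> Ev c]]]]] := HL s Ls.
  rewrite -[s]take_size szL // -bits_unbits ?szL // => /prefix_str_bits.
  rewrite size_bits => -[len /bits_mod E]; apply/hasP; exists t; first by rewrite mem_iota ltnS.
  rewrite Ev eqxx -(per_cov m trA (_ : i = unbits (bits n (unbits s)) %[mod 2 ^ t])) // E.
  by rewrite unbits_bits modn_dvdm // dvdn_exp2l.
apply: leq_trans (_ : card Y n * 2 ^ m <= _); first by rewrite leq_mul2r leL orbT.
pose p t := (t <= n) && (ver A m t == v).
case: (classic (exists t, p t)) => [ex|none]; last first.
  rewrite /card (eq_count (a2 := pred0)) ?count_pred0 // => x; apply/hasP => -[t].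
  rewrite mem_iota add0n ltnS => /= len /andP[Ev _]; apply: none; exists t.
  by rewrite /p len.
have leT t : p t -> t <= n by case/andP.
have [T /andP[lenT /eqP EvT] maxT] := ex_maxnP ex leT.
have [s /andP[lens /eqP Evs] mins] := ex_minnP ex.
have H1 : card (fun x => Y x && A T x) n * 2 ^ m.+1 <= 2 ^ n.
  apply: leq_trans (_ : (\sum_(0 <= l < T) card (fun x => (2 * l + m.+2 <= T) && (A T x && lead A m T l x)) n)
      * 2 ^ m.+1 <= _).
    rewrite leq_mul2r; apply/orP; right; apply: leq_trans (count_has_sum _ _ _).
    apply: sub_count => x /andP[/hasP[t]]; rewrite mem_iota add0n ltnS => /= len.
    move=> /andP[/eqP Ev /andP[_ /hasP[l ltl /andP[le lx]]]] AT.
    have let_T : t <= T by apply: maxT; rewrite /p len Ev eqxx.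
    apply/hasP; exists l; last by rewrite (leq_trans le let_T) AT (lead_mono trA le let_T).
    by move: ltl; rewrite !mem_iota !add0n => /= /leq_trans; apply.
  rewrite big_distrl /=; apply: geometric_sum_bound => l ltl.
  case: (leqP (2 * l + m.+2) T) => [le|_]; last by rewrite /card count_pred0.
  by rewrite -mulnA -expnD (_ : m.+1 + l.+1 = l + m.+2) ?lead_card //; lia.
have H2 : card (fun x => A s x && ~~ A T x) n * 2 ^ m.+2 <= 2 ^ n.
  have lesT : s <= T by apply: maxT; rewrite /p lens Evs eqxx.
  have Esplit : card (A s) n = card (A T) n + card (fun x => A s x && ~~ A T x) n.
    rewrite /card -[LHS]size_filter -(count_predC (A T)) !count_filter.
    congr (_ + _); apply: eq_count => x /=; last by rewrite andbC.
    by case AT : (A T x) => //=; rewrite (monoA _ _ _ lesT AT).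
  have := leq_trunc_div (card (A T) T * 2 ^ m.+2) (2 ^ T).
  have := ltn_ceil (card (A s) s * 2 ^ m.+2) (expn_gt0 2 s).
  rewrite -/(ver A m s) -/(ver A m T) EvT Evs => Hs HT.
  have {}Hs : card (A s) n * 2 ^ m.+2 < v.+1 * 2 ^ n.
    rewrite (card_per lens (perA s)) -mulnA -[X in _ < _ * 2 ^ X](subnK lens) expnD [X in _ < X]mulnCA.
    by rewrite ltn_pmul2l ?expn_gt0.
  have {}HT : v * 2 ^ n <= card (A T) n * 2 ^ m.+2.
    rewrite (card_per lenT (perA T)) -mulnA -[X in _ * 2 ^ X <= _](subnK lenT) expnD [X in X <= _]mulnCA.
    by rewrite leq_mul2l HT orbT.
  by move: Hs HT; rewrite Esplit mulnDl mulSn; lia.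
have : card Y n <= card (fun x => Y x && A T x) n + card (fun x => A s x && ~~ A T x) n.
  rewrite /card -count_predUI; apply: leq_trans (leq_addr _ _); apply: sub_count => x Yx.
  apply/orP; rewrite /= Yx; case AT : (A T x) => /=; [by left | right].
  have /hasP[t] := Yx; rewrite mem_iota add0n ltnS => /= len /andP[Ev /andP[Atx _]].
  by rewrite (monoA _ _ _ _ Atx) // mins // /p len.
move: H1 H2; rewrite !(expnS 2 m.+1) !(expnS 2 m); nia.
Qed.

Lemma decr_stabilizes (v : nat -> nat) : (forall s t, s <= t -> v t <= v s) ->
  exists t0, forall t, t0 <= t -> v t = v t0.
Proof.
move=> dv; apply: NNPP => nex.
have H n : exists t, v t + n <= v 0.
  elim: n => [|n [t Ht]]; first by exists 0; rewrite addn0.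
  have [t' [le ne]] : exists t', t <= t' /\ v t' <> v t.
    apply: NNPP => H; apply: nex; exists t => t' le; apply: NNPP => ne.
    by apply: H; exists t'.
  by exists t'; have := dv t t' le; lia.
by have [t] := H (v 0).+1; lia.
Qed.

(** Each change lowers the value, so sending a change [t] to [v t.+1] is injective into the numbers
    below [v 0]. *)
Lemma decr_changes (v : nat -> nat) (s : seq nat) : (forall s t, s <= t -> v t <= v s) ->
  uniq s -> (forall t, t \in s -> v t.+1 != v t) -> size s <= v 0.
Proof.
move=> dv us Hs.
have lt t : t \in s -> v t.+1 < v t by move=> /Hs ne; have := dv t t.+1 (leqnSn t); lia.
rewrite -(size_map (fun t => v t.+1)) -[X in _ <= X](size_iota 0); apply: uniq_leq_size.
  rewrite map_inj_in_uniq // => x y /lt ltx /lt lty E.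
  by case: (ltngtP x y) => // /dv; lia.
by move=> _ /mapP[t /lt ltt ->]; rewrite mem_iota add0n /=; have := dv 0 t isT; lia.
Qed.

(** From the stage given by [dead_stage] on, the live nodes of level 2l+m+2 are the extendible ones.
    The leading node above [j] is then the least extendible one, and every extendible continuation
    of it is covered. *)
Lemma dense_version A m v t0 l j : istree A -> (forall t, t0 <= t -> ver A m t = v) -> ext A l j ->
  exists t i, [/\ l <= t, i = j %[mod 2 ^ l], ext A t i, ver A m t = v & cov A m t i].
Proof.
move=> trA Hv extj; set L := 2 * l + m.+2; have lelL : l <= L by rewrite /L; lia.
have [T leLT dead] := dead_stage L trA.
have [t [leTt let0t ltlt]] : exists t, [/\ T <= t, t0 <= t & l < t].
  by exists (maxn (maxn T t0) l.+1); rewrite !leq_max !leqnn !orbT.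
have leLt := leq_trans leLT leTt.
have [j1 E1 ext1] := ext_extend trA extj lelL.
pose p j' := (j' == j %[mod 2 ^ l]) && (0 < cnt A t L j').
have cnt_ext j' : (0 < cnt A t L j') -> ext A L j'.
  rewrite /cnt /card -has_count => /hasP[x _ /andP[Ax /eqP Ex]]; apply: NNPP => next.
  exact: dead next leTt Ax Ex.
have ext_cnt j' : ext A L j' -> 0 < cnt A t L j'.
  move=> /(_ t leLt)[x /andP[Ax /eqP Ex]]; rewrite -(cnt_mod A t Ex); exact: cnt_gt0.
have exp : exists j', p j' by exists j1; rewrite /p E1 eqxx ext_cnt.
have [r /andP[/eqP Er cr] minr] := ex_minnP exp.
have [i Ei exti] := ext_extend trA (cnt_ext _ cr) leLt.
exists t, i; split=> //; first exact: ltnW.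
- by rewrite (eq_mod_pow2 lelL Ei).
- exact: Hv.
rewrite /cov (ext_sat trA exti); apply/hasP; exists l; first by rewrite mem_iota add0n.
rewrite -/L leLt; apply/allP => j'; rewrite mem_iota add0n -/L Ei => /= ltj.
rewrite (eq_mod_pow2 lelL Ei) Er.
case Ej : (j' == j %[mod _]) => //=; rewrite -leqn0 leqNgt; apply/negP => cj.
have := minr j'; rewrite /p Ej cj => /(_ isT) ler.
by have := leq_trans ltj (leq_trans (leq_mod r _) ler); rewrite ltnn.
Qed.

(** The function [g] follows the current version and [f] picks the final one. Version numbers start
    at no more than 2^(m+2) and never increase, which bounds the changes. *)
Lemma dense_test A : ctree A -> exists S, demuth_test S /\
  forall m l j, ext A l j -> exists t i, [/\ l <= t, i = j %[mod 2 ^ l], ext A t i &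
    forall Z, zp Z t = i %[mod 2 ^ t] -> S m Z].
Proof.
move=> ctA; have [trA cA] := ctA; have [idx [cidx Hidx]] := version_index ctA.
have dv m s t := @ver_decr A m s t trA.
have /(fun H m => constructive_indefinite_description _ (H m)) T :
  forall m, exists t0, forall t, t0 <= t -> ver A m t = ver A m t0.
  by move=> m; apply: decr_stabilizes => s t; exact: dv.
pose f m := idx (npair m (ver A m (sval (T m)))).
pose g m t := idx (npair m (ver A m t)).
exists (fun m => opengen (W (f m))); split.
  exists f, g, (fun m => 2 ^ m.+2); split; [| split; [| split; [| split; [| split]]]].
  - have [p Hp] : cf 2 (fun v => g (nth 0 v 0) (nth 0 v 1)).
      apply: (C1_comp cidx); have cv : cf 2 (fun v => ver A (nth 0 v 0) (nth 0 v 1)) by exact: C2_ver.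
      by apply: cf_add; last cf_tac; apply: cf_mul; apply: cf_add; try exact: cv; cf_tac.
    by exists p => x y; exact: (Hp [:: x; y]).
  - have [p Hp] : cf 1 (fun v => 2 ^ (nth 0 v 0).+2) by cf_tac.
    by exists p => x; exact: (Hp [:: x]).
  - by move=> m; exists (sval (T m)) => t /(svalP (T m)); rewrite /g /f => ->.
  - move=> m s us Hs; apply: leq_trans (_ : ver A m 0 <= _).
      apply: decr_changes us _ => [s' t'|t /Hs]; first exact: dv.
      by apply: contra_neq; rewrite /g => ->.
    by rewrite /ver divn1 -[X in _ <= X]mul1n leq_mul2r (card_le _ 0) orbT.
  - move=> m n L uL szL HL; apply: (version_measure (A := A) (v := ver A m (sval (T m)))) => // t.
    by move=> /HL[s [/Hidx Hs Ps]]; exists s.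
  - by [].
move=> m l j extj; have [t [i [le Ei exti Ev c]]] := dense_version trA (svalP (T m)) extj.
exists t, i; split=> // Z EZ; exists (bits t i); split; first by apply/Hidx; exists t, i.
by apply/prefix_of_bits.
Qed.

(** * Forcing *)

Lemma dependent_choice (C : Type) (I : C -> Prop) (R : nat -> C -> C -> Prop) (c0 : C) :
  I c0 -> (forall n c, I c -> exists2 c', I c' & R n c c') ->
  exists u : nat -> C, forall n, I (u n) /\ R n (u n) (u n.+1).
Proof.
move=> I0 step.
have /(fun H n c => constructive_indefinite_description _ (H n c)) next :
  forall n c, exists c', I c -> I c' /\ R n c c'.
  move=> n c; case: (classic (I c)) => [/(step n)[c' Ic' Rc]|nI]; first by exists c'.
  by exists c0.
pose u := nat_rect (fun=> C) c0 (fun n c => sval (next n c)).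
have Iu n : I (u n) by elim: n => //= n /(svalP (next n (u n)))[].
by exists u => n; have [] := svalP (next n (u n)) (Iu n).
Qed.

Lemma limit_real (l j : nat -> nat) :
  (forall n, l n < l n.+1 /\ j n.+1 = j n %[mod 2 ^ l n]) ->
  exists Z, forall n, zp Z (l n) = j n %[mod 2 ^ l n].
Proof.
move=> H; have ltl n : n <= l n by elim: n => // n IH; have [] := H n; lia.
have coh n d : l n <= l (n + d) /\ j (n + d) = j n %[mod 2 ^ l n].
  elim: d => [|d [le E]]; first by rewrite addn0.
  have [lt E'] := H (n + d); rewrite addnS; split; first exact: leq_trans le (ltnW lt).
  by rewrite (eq_mod_pow2 le E').
have same n m c : n <= m -> c < l n -> odd (j n %/ 2 ^ c) = odd (j m %/ 2 ^ c).
  move=> /subnKC <- ltc; have [le /bits_mod E] := coh n (m - n).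
  by rewrite -(nth_bits (j n) ltc) -E nth_bits.
(* As [l c.+1 > c], the string coded by [j c.+1] already fixes bit [c]. *)
exists (fun c => odd (j c.+1 %/ 2 ^ c)) => n; apply/bits_mod; rewrite bits_zp //.
apply: (@eq_from_nth _ false); first by rewrite size_mkseq size_bits.
move=> c; rewrite size_mkseq => ltc; rewrite nth_mkseq // nth_bits //.
by rewrite (same c.+1 (maxn n c.+1)) ?leq_maxr // (same n (maxn n c.+1)) ?leq_maxl.
Qed.

Lemma pos_ext A : istree A -> pos A -> ext A 0 0.
Proof.
move=> [_ monoA] [q Hq] t _; have := Hq _ (leq_maxr t q).
have : 0 < 2 ^ maxn t q by rewrite expn_gt0.
case: (posnP (card (A (maxn t q)) (maxn t q))) => [->|]; first by lia.
rewrite /card -has_count => /hasP[x _ Ax] _ _; exists x.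
by rewrite (monoA _ _ _ _ Ax) ?leq_maxl //= !modn1.
Qed.

Lemma avoid_Gdelta A (U : nat -> seq bool -> Prop) : ctree A -> pos A ->
  (forall Z, (forall n, opengen (U n) Z) -> weakly_Demuth_random Z) ->
  exists A', [/\ ctree A', pos A', forall t i, A' t i -> A t i &
    forall Z, path A' Z -> ~ forall n, opengen (U n) Z].
Proof.
move=> ctA posA subU; have [c posB] := prune_pos ctA.1 posA.
have ctB := prune_ctree c ctA; have fatB := prune_fat c ctA.1.
set B := prune A c in ctB fatB posB; have leB t i : B t i -> A t i by case/andP.
apply: NNPP => none.
(* Otherwise [restr B l j], which has positive measure because [B] is fat, would avoid the set. *)
have dense l j : ext B l j -> exists Z, [/\ path B Z, zp Z l = j %[mod 2 ^ l] &
    forall n, opengen (U n) Z].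
  move=> extj; apply: NNPP => nZ; apply: none; exists (restr B l j); split.
  - exact: restr_ctree.
  - exact: restr_pos.
  - by move=> t i /andP[/leB].
  - by move=> Z /path_restr[pZ EZ] UZ; apply: nZ; exists Z.
have [S [testS denseS]] := dense_test ctB.
(* The states are extendible nodes of [B]. Step [n] first enters [U n] by following a member of the
   set, then enters [S n] by density of the test. *)
have [||u Hu] := @dependent_choice (nat * nat) (fun x => ext B x.1 x.2)
  (fun n x y => (x.1 < y.1 /\ y.2 = x.2 %[mod 2 ^ x.1]) /\
    forall Z, zp Z y.1 = y.2 %[mod 2 ^ y.1] -> opengen (U n) Z /\ S n Z) (0, 0).
- exact: pos_ext ctB.1 posB.
- move=> n [l j] /= extj; have [Z [pZ EZ UZ]] := dense l j extj.
  have [s [Us /prefix_of_mkseq Es]] := UZ n.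
  (* This length suffices both to enter [U n] along [Z] and to grow strictly. *)
  pose k := maxn l.+1 (size s); have ltlk : l < k by rewrite leq_maxl.
  have [t [i [lekt Ei exti SZ]]] := denseS n k (zp Z k) (@path_ext _ _ k pZ).
  exists (t, i) => //; split=> /=.
    split; first exact: leq_trans lekt.
    by rewrite (eq_mod_pow2 (ltnW ltlk) Ei) zp_mod // ltnW.
  move=> Z' EZ'; split; last exact: SZ.
  exists s; split=> //; apply/prefix_of_mkseq; rewrite {1}Es.
  have les : size s <= k by rewrite leq_maxr.
  rewrite -(bits_zp Z les) -(bits_zp Z' les); apply/bits_mod; apply: (eq_mod_pow2 les).
  by rewrite -Ei -(eq_mod_pow2 lekt EZ') zp_mod.
have [|Z HZ] := @limit_real (fun n => (u n).1) (fun n => (u n).2).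
  by move=> n; have [_ []] := Hu n.
have USZ n : opengen (U n) Z /\ S n Z by have [_ [_]] := Hu n; apply; exact: HZ.
have [m] := subU Z (fun n => (USZ n).1) S testS.
by apply; have [] := USZ m.
Qed.

(** If [p] computes no test, [A] itself serves. Otherwise [p] determines the limit function, so
    avoiding one component is enough; component q+1 has at most half of the mass 2^-q of [A]. *)
Lemma avoid_test A p : ctree A -> pos A ->
  exists A', [/\ ctree A', pos A', forall t i, A' t i -> A t i &
    forall f g, (forall x y, eval p [:: x; y] (g x y)) ->
      (forall m, exists t0, forall t, t0 <= t -> g m t = f m) ->
      (forall m, measure_le_pow2 (W (f m)) m) ->
      forall Z, path A' Z -> exists m, ~ opengen (W (f m)) Z].
Proof.
move=> ctA posA; have [q Hq] := posA.
case: (classic (exists f g, [/\ forall x y, eval p [:: x; y] (g x y),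
      forall m, exists t0, forall t, t0 <= t -> g m t = f m &
      forall m, measure_le_pow2 (W (f m)) m])) => [[f [g [Hg Hf Wf]]]|none]; last first.
  exists A; split=> // f g Hg Hf Wf; case: none; by exists f, g.
have [A' [ctA' posA' leA' HA']] := avoid_ce_open ctA (fun t lt => Hq t (ltnW lt)) (Wf q.+1).
exists A'; split=> // f' g' Hg' Hf' _ Z /HA' nZ; exists q.+1.
have [t Ht] := Hf q.+1; have [t' Ht'] := Hf' q.+1.
rewrite -(Ht' _ (leq_maxr t t')) (eval_fun (Hg' _ _) (Hg _ _)) Ht ?leq_maxl //.
Qed.

Theorem mainTheorem8 : ~ boldface_Sigma03 weakly_Demuth_random.
Proof.
move=> [U HU].
(* A condition comes with a stem, coded by [x.2] and of length [x.1.2], that all nodes at least as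
   long extend; the stems converge to the real. *)
pose I (x : (nat -> nat -> bool) * nat * nat) := [/\ ctree x.1.1, pos x.1.1 &
  forall t i, x.1.2 <= t -> x.1.1 t i -> i = x.2 %[mod 2 ^ x.1.2]].
(* Step [n] treats the [n]-th set of the union and the [n]-th program, as a possible approximation
   of a test. *)
pose R n (x y : (nat -> nat -> bool) * nat * nat) :=
  [/\ forall t i, y.1.1 t i -> x.1.1 t i, x.1.2 < y.1.2, y.2 = x.2 %[mod 2 ^ x.1.2],
    forall Z, path y.1.1 Z -> ~ forall j, opengen (U n j) Z &
    forall f g, (forall x y, eval (prog n) [:: x; y] (g x y)) ->
      (forall m, exists t0, forall t, t0 <= t -> g m t = f m) ->
      (forall m, measure_le_pow2 (W (f m)) m) ->
      forall Z, path y.1.1 Z -> exists m, ~ opengen (W (f m)) Z].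
have [||u Hu] := @dependent_choice _ I R (fun _ _ => true, 0, 0).
- split=> [||t i _ _] /=; last by rewrite !modn1.
    by split; [split | exact: cf_const].
  by exists 0 => t _; rewrite muln1 /card count_predT size_iota.
- move=> n [[A l] j] [/= ctA posA Aj].
  have [|A1 [ct1 pos1 le1 H1]] := avoid_Gdelta (U := U n) ctA posA.
    by move=> Z UZ; apply/HU; exists n.
  have [A2 [ct2 pos2 le2 H2]] := avoid_test (prog n) ct1 pos1.
  have [c pos3] := prune_pos ct2.1 pos2.
  have ct3 := prune_ctree c ct2; have fat3 := prune_fat c ct2.1.
  set B := prune A2 c in ct3 fat3 pos3; have leB t i : B t i -> A2 t i by case/andP.
  (* Any extendible node of level [l.+1] can be the new stem: its extensions lie in [A], so it
     agrees with the old one. *)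
  have [i _ exti] := ext_extend ct3.1 (pos_ext ct3.1 pos3) (leq0n l.+1).
  have pathB Z : path (restr B l.+1 i) Z -> path A2 Z.
    by move=> /path_restr[pZ _] t; exact: leB.
  exists (restr B l.+1 i, l.+1, i); split=> /=.
  + exact: restr_ctree.
  + exact: restr_pos.
  + by move=> t x le /andP[_]; rewrite ltnNge le => /eqP.
  + by move=> t x /andP[/leB/le2/le1].
  + exact: leqnn.
  + have [x /andP[/leB/le2/le1 Ax /eqP Ex]] := exti l.+1 (leqnn _).
    by rewrite -(Aj _ _ (leqnSn l) Ax) (eq_mod_pow2 (leqnSn l) Ex).
  + by move=> Z /pathB pZ; apply: H1 => t; exact: le2.
  + by move=> f g Hg Hf Wf Z /pathB; exact: H2 Hg Hf Wf Z.
have [|Z HZ] := @limit_real (fun n => (u n).1.2) (fun n => (u n).2).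
  by move=> n; have [_ []] := Hu n.
have ltl n : n <= (u n).1.2 by elim: n => // n IH; have [_ [_ lt _ _ _]] := Hu n; exact: leq_ltn_trans lt.
have decr n d t i : (u (n + d)).1.1 t i -> (u n).1.1 t i.
  elim: d => [|d IH]; first by rewrite addn0.
  by rewrite addnS; have [_ [le _ _ _ _]] := Hu (n + d) => /le.
(* The stem of condition [n + t] has length at least [t] and an extension in its own tree, hence in
   the earlier tree [n]. *)
have pZ n : path (u n).1.1 Z.
  move=> t; pose N := n + t; have leN : t <= (u N).1.2 by rewrite (leq_trans _ (ltl N)) ?leq_addl.
  have [[[trN _] posN AN] _] := Hu N; have [[[[perA monoA] _] _ _] _] := Hu n.
  have [x /andP[Ax _]] := pos_ext trN posN (leq0n (u N).1.2).
  have Ex := AN _ _ (leqnn _) Ax.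
  rewrite (perA t _ x); first exact: monoA leN (decr _ _ _ _ Ax).
  by rewrite (eq_mod_pow2 leN Ex) -(eq_mod_pow2 leN (HZ N)) zp_mod.
have WZ : weakly_Demuth_random Z.
  move=> S [f [g [b [[p Hp] [_ [Hf [_ [Wf HS]]]]]]]]; have [e Ee] := prog_surj p.
  (* The program computing the approximation [g] has an index [e], and step [e] made every path of
     the next tree leave some component. *)
  have [_ [_ _ _ _ /(_ f g)]] := Hu e; rewrite Ee => /(_ Hp Hf Wf Z (pZ e.+1))[m Hm].
  by exists m => /HS.
(* Step [n] has already excluded [Z] from the set that would witness its membership in the union. *)
have [n Hn] := (HU Z).1 WZ; have [_ [_ _ _ + _]] := Hu n.
exact.
Qed.
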